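(* Let $X_1,X_2,\dots$ be independent and identically distributed random variables with values in a measurable space $\mathcal{X}$, let $h:\mathcal{X}^2\to\mathbb{R}$ be measurable and symmetric, and let $$U_n:=U_n(h):=\frac1{\binom n2}\sum_{1\le i_1<i_2\le n}h(X_{i_1},X_{i_2}).$$ Let $h_1(x):=\mathbb{E}[h(x,X_2)]$ and $\sigma_1^2:=\mathbb{V}[h_1(X_1)]$. Assume $0<\sigma_1^2<\infty$ and that there exist constants $\gamma\ge1$ and $C>0$ such that $$\mathbb{E}\bigl[|h(X_1,X_2)|^j\bigr]\le C^j(j!)^\gamma\qquad\text{for all }j\ge3.$$ Put $Z_n:=\frac{U_n-\mathbb{E}U_n}{\sqrt{\mathbb{V}(U_n)}}$ and let $N$ be a standard normally distributed random variable. Then for every even $k\ge4$ there is a constant $C_1(k)$, not depending on $n$, such that for all sufficiently large $n$ $$\bigl|\mathbb{E}(Z_n^k)-\mathbb{E}(N^k)\bigr|\le C_1(k)\,\frac1n.$$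
   Context: $\mathbb{V}$ denotes variance. *)

(* Defs.v *)
From HB Require Import structures.
From mathcomp Require Import all_boot all_order all_algebra.
From mathcomp Require Import all_classical all_reals all_analysis.
Set Implicit Arguments.
Unset Strict Implicit.
Unset Printing Implicit Defensive.
Import Order.TTheory GRing.Theory Num.Theory.
Import numFieldNormedType.Exports.
Local Open Scope classical_set_scope.
Local Open Scope ring_scope.

Section Independence.
Context (d d' : measure_display) (T : measurableType d) (E : measurableType d')
  (R : realType) (P : probability T R).

Definition mutually_independent (X : nat -> {RV P >-> E}) : Prop :=
  forall (J : seq nat) (A : nat -> set E),
    uniq J -> (forall i, measurable (A i)) ->
    P (\big[setI/setT]_(i <- J) (X i @^-1` A i)) =
      (\prod_(i <- J) P (X i @^-1` A i))%E.

Definition identically_distributed (X : nat -> {RV P >-> E}) : Prop :=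
  forall (i j : nat) (A : set E), measurable A ->
    distribution P (X i) A = distribution P (X j) A.

Definition iid (X : nat -> {RV P >-> E}) : Prop :=
  mutually_independent X /\ identically_distributed X.

End Independence.

Definition standard_normal (d : measure_display) (T : measurableType d)
    (R : realType) (P : probability T R) (N : {RV P >-> R}) : Prop :=
  forall A : set R, measurable A -> distribution P N A = normal_prob 0 1 A.

(* Sequences are indexed from 0: the sample (X_1, ..., X_n) is
   (X 0, ..., X n.-1). *)
Section UStatistic.
Context (d d' : measure_display) (T : measurableType d) (E : measurableType d')
  (R : realType) (P : probability T R).
Variables (X : nat -> {RV P >-> E}) (h : E * E -> R).

Definition Ustat (n : nat) (w : T) : R :=
  ('C(n, 2)%:R)^-1 * \sum_(i < n) \sum_(j < n | (i < j)%N) h (X i w, X j w).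

(* [fine] only has an effect at the points x where the expectation is infinite;
   they form a null set for the law of X 0 when h (X 0, X 1) is integrable. *)
Definition h1 (x : E) : R := fine 'E_P[fun w => h (x, X 1%N w)]%E.

Definition sigma1_sq : \bar R := 'V_P[h1 \o X 0%N]%E.

Definition Zstat (n : nat) (w : T) : R :=
  (Ustat n w - fine 'E_P[Ustat n]%E) / Num.sqrt (fine 'V_P[Ustat n]%E).

End UStatistic.

(* Main.v *)
Require Import Defs.
From HB Require Import structures.
From mathcomp Require Import all_boot all_order all_algebra.
From mathcomp Require Import all_classical all_reals all_analysis.
From mathcomp Require Import measurable_realfun.
From mathcomp Require Import zify ring lra.
Set Implicit Arguments.
Unset Strict Implicit.
Unset Printing Implicit Defensive.
Import Order.TTheory GRing.Theory Num.Theory.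
Import numFieldNormedType.Exports.
Local Open Scope classical_set_scope.
Local Open Scope ring_scope.

(* Write h(x, y) - theta = g1(x) + g1(y) + g2(x, y) (Hoeffding), so that
   S_n := sum_(i < j) (h(X_i, X_j) - theta) = (n - 1) L_n + W_n with
   L_n = sum_i g1(X_i) and W_n = sum_(i < j) g2(X_i, X_j), and
   Z_n = S_n / sqrt(E S_n^2).  Put k = 2q.  In the expansion of E S_n^k over
   k-tuples of pairs (i <= j), where the loop (i, i) stands for the factor
   (n - 1) g1(X_i), a term vanishes as soon as some index occurs in exactly one
   factor.  A surviving tuple with l loops, v distinct indices and l < k has
   l + v < 3q; since sum_t n^(-v(t)) is bounded in n, the tuples containing some
   g2 contribute only O(n^(3q - 1)), and the others sum up to
   (n - 1)^k E L_n^k.  Expanding L_(n+1)^k = (L_n + g1(X_n))^k gives a recursion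
   in n from which E L_n^k = (2q - 1)!! s^q n^q + O(n^(q - 1)), s = E g1(X_1)^2.
   Hence E S_n^k = (2q - 1)!! s^q n^(3q) + O(n^(3q - 1)); dividing by
   (E S_n^2)^q, which is the same estimate for q = 1, leaves
   (2q - 1)!! + O(1/n), and (2q - 1)!! is the k-th normal moment. *)

(** * Independent pairs *)

(** The rate 1/n, rather than n^(-1/2), is a matter of parity: for even k the exponents in question
    are integers, so both the tuples containing some g2 and the error of E L_n^k lose a whole power
    of n. Treating (n - 1) g1(X_i) as a loop makes S_n a single sum over pairs, so that one
    incidence count serves both Hoeffding parts.

    The delicate step is the vanishing of tuples. Integrating out X_v while all other variables are
    frozen needs X_v to be independent of the others jointly; these are therefore gathered into one
    random variable, the identity into the sample space with a coarser sigma-algebra. Moreover a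
    section of h is integrable only for almost every value of the fixed argument, so the centering
    of g2 is available only almost everywhere.

    All constants depend on k and on moments of g1 and g2, never on n. *)

Definition mfun_of d1 d2 (T1 : measurableType d1) (T2 : measurableType d2)
    (f : T1 -> T2) (mf : measurable_fun setT f) : {mfun T1 >-> T2} :=
  MeasurableFun.Pack (MeasurableFun.Class (isMeasurableFun.Build _ _ _ _ _ mf)).

Section IndependentPair.
Context d d1 d2 (T : measurableType d) (T1 : measurableType d1)
  (T2 : measurableType d2) (R : realType) (P : probability T R).
Variables (Y : {RV P >-> T1}) (Z : {RV P >-> T2}).
Hypothesis YZ_indep : forall A B, measurable A -> measurable B ->
  P (Y @^-1` A `&` Z @^-1` B) = (P (Y @^-1` A) * P (Z @^-1` B))%E.

Let pair_fun (w : T) := (Y w, Z w).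

Let measurable_pair_fun : measurable_fun setT pair_fun.
Proof. by apply/measurable_fun_pairP; split; exact: measurable_funP. Qed.

(** Uniqueness of product measures: both sides agree on rectangles by [YZ_indep]. *)
Lemma distribution_indep_pair (C : set (T1 * T2)) : measurable C ->
  (distribution P Y \x distribution P Z)%E C =
  distribution P (mfun_of measurable_pair_fun) C.
Proof.
by move=> mC; apply: product_measure_unique => // A B; exact: YZ_indep.
Qed.

Lemma ge0_integral_indep_pair (F : T1 * T2 -> \bar R) :
  measurable_fun setT F -> (forall z, (0 <= F z)%E) ->
  (\int[P]_w F (Y w, Z w) =
   \int[distribution P Y \x distribution P Z]_z F z)%E.
Proof.
move=> mF F0.
rewrite [RHS](eq_measure_integral (distribution P (mfun_of measurable_pair_fun))).
  by rewrite ge0_integral_distribution.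
by move=> C mC _; exact: distribution_indep_pair.
Qed.

Section Fubini.
Variable F : T1 * T2 -> \bar R.
Hypotheses (mF : measurable_fun setT F)
  (iF : P.-integrable setT (fun w => F (Y w, Z w))).

Lemma integrable_indep_pair :
  (distribution P Y \x distribution P Z)%E.-integrable setT F.
Proof.
apply/integrableP; split=> //; rewrite -ge0_integral_indep_pair//.
  by case/integrableP: iF.
exact: measurableT_comp.
Qed.

Lemma integral_indep_pair :
  (\int[P]_w F (Y w, Z w) =
   \int[distribution P Z]_z \int[distribution P Y]_y F (y, z))%E.
Proof.
rewrite (integral21_prod_meas1 integrable_indep_pair).
rewrite [RHS](eq_measure_integral (distribution P (mfun_of measurable_pair_fun))).
  by rewrite integral_distribution.
by move=> C mC _; exact: distribution_indep_pair.
Qed.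

Lemma ae_integrable_indep_pair : {ae distribution P Z, forall z,
  (distribution P Y).-integrable setT (fun y => F (y, z))}.
Proof. exact: (ae_integrable2 integrable_indep_pair). Qed.

(** The inner integral is required to vanish only almost everywhere, because the sections of an
    integrable [F] are themselves integrable only almost everywhere. *)
Lemma integral_indep_pair0 :
  {ae distribution P Z, forall z, (\int[distribution P Y]_y F (y, z) = 0)%E} ->
  (\int[P]_w F (Y w, Z w) = 0)%E.
Proof.
move=> F0; rewrite integral_indep_pair.
rewrite (ae_eq_integral (cst 0%E))//; first by rewrite integral0.
- exact: (measurable_fubini_G integrable_indep_pair).
- by apply: filterS F0 => w /= -> _.
Qed.

End Fubini.
End IndependentPair.

(** * One variable against all the others *)

Section OneVsRest.
Context d d' (T : measurableType d) (E : measurableType d') (R : realType)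
  (P : probability T R).
Variables (X : nat -> {RV P >-> E}) (v : nat).

(** Cylinders over finitely many coordinates that leave coordinate [v] free ([A v = setT]). They
    form a pi-system generating the sigma-algebra of the [X i] with [i != v]. *)
Definition cylinders_off : set (set T) :=
  [set B | exists (n : nat) (A : nat -> set E),
    [/\ forall i, measurable (A i), A v = setT,
        forall i, (n <= i)%N -> A i = setT &
        B = [set w | forall i, A i (X i w)]]].

(** The sample space with the coarser sigma-algebra of the variables other than [X v]. The identity
    into it, [off_RV], is one random variable carrying all of them, so that Fubini for a pair
    applies. *)
Definition off_type : measurableType cylinders_off.-sigma :=
  g_sigma_algebraType cylinders_off.

Lemma cylinder_bigsetI n (A : nat -> set E) :
  A v = setT -> (forall i, (n <= i)%N -> A i = setT) ->
  [set w | forall i, A i (X i w)] =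
  \big[setI/setT]_(i <- [seq i <- iota 0 n | i != v]) (X i @^-1` A i).
Proof.
move=> Av An; apply/seteqP; split=> [w Aw|w].
  by elim/big_ind : _ => //= i _; exact: Aw.
rewrite -bigcap_seq => Aw i.
have [->|iv] := eqVneq i v; first by rewrite Av.
have [ni|ni] := leqP n i; first by rewrite An.
by apply: (Aw i); rewrite /= mem_filter iv mem_iota.
Qed.

Lemma measurable_cylinders_off : cylinders_off `<=` measurable.
Proof.
move=> _ [n [A [mA Av An ->]]]; rewrite (cylinder_bigsetI Av An).
apply: bigsetI_measurable => i _; rewrite -[_ @^-1` _]setTI.
exact: measurable_funP.
Qed.

Lemma setI_closed_cylinders_off : setI_closed cylinders_off.
Proof.
move=> _ _ [n1 [A1 [mA1 A1v A1n ->]]] [n2 [A2 [mA2 A2v A2n ->]]].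
exists (maxn n1 n2), (fun i => A1 i `&` A2 i); split.
- by move=> i; exact: measurableI.
- by rewrite A1v A2v setTI.
- by move=> i; rewrite geq_max => /andP[/A1n -> /A2n ->]; rewrite setTI.
- by apply/seteqP; split=> [w [? ?] i|w H]; split=> // i; have [] := H i.
Qed.

Lemma cylinders_offT : cylinders_off setT.
Proof.
by exists 0%N, (fun=> setT); split=> //; apply/seteqP; split.
Qed.

Lemma measurable_off_subset (B : set T) :
  measurable (B : set off_type) -> measurable B.
Proof.
exact: (smallest_sub (@sigma_algebra_measurable _ T) measurable_cylinders_off).
Qed.

Lemma measurable_off_id : measurable_fun [set: T] (id : T -> off_type).
Proof. by move=> _ B mB; rewrite setTI; exact: measurable_off_subset. Qed.

Lemma measurable_off_X i : i != v -> measurable_fun [set: off_type] (X i).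
Proof.
move=> iv _ A mA; rewrite setTI; apply: sub_sigma_algebra.
exists i.+1, (fun j => if j == i then A else setT); split.
- by move=> j; case: ifP.
- by rewrite eq_sym (negbTE iv).
- by move=> j ij; rewrite ifF//; apply/eqP => ji; rewrite ji ltnn in ij.
- apply/seteqP; split=> [w /= Aw j|w /= /(_ i)]; last by rewrite eqxx.
  by case: eqVneq => [->|].
Qed.

Hypothesis X_indep : mutually_independent X.

Lemma indep_cylinders_off (A : set E) (B : set T) :
  measurable A -> cylinders_off B ->
  P (X v @^-1` A `&` B) = (P (X v @^-1` A) * P B)%E.
Proof.
move=> mA [n [A' [mA' A'v A'n ->]]]; rewrite (cylinder_bigsetI A'v A'n).
set J := [seq _ <- _ | _].
have vJ : v \notin J by rewrite mem_filter eqxx.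
have uJ : uniq J by rewrite filter_uniq// iota_uniq.
pose A2 j := if j == v then A else A' j.
have mA2 j : measurable (A2 j) by rewrite /A2; case: ifP.
have JE i : i \in J -> A2 i = A' i.
  by rewrite /A2; case: eqVneq => // ->; rewrite (negbTE vJ).
have := X_indep (J := v :: J) (A := A2).
rewrite /= vJ uJ => /(_ erefl mA2); rewrite !big_cons {1 3}/A2 eqxx.
rewrite (X_indep uJ mA').
rewrite (eq_big_seq (fun i => X i @^-1` A' i)); last by move=> i /JE ->.
by rewrite (eq_big_seq (fun i => P (X i @^-1` A' i))); last by move=> i /JE ->.
Qed.

(** Both sides are finite measures in [B]; they agree on the pi-system of cylinders, hence on the
    sigma-algebra it generates. *)
Lemma indep_off (A : set E) (B : set T) :
  measurable A -> measurable (B : set off_type) ->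
  P (X v @^-1` A `&` B) = (P (X v @^-1` A) * P B)%E.
Proof.
move=> mA mB.
have mXA : measurable (X v @^-1` A).
  by rewrite -[_ @^-1` _]setTI; exact: measurable_funP.
have PAfin : P (X v @^-1` A) \is a fin_num by exact: fin_num_measure.
have PAge0 : 0 <= fine (P (X v @^-1` A)) by rewrite fine_ge0.
pose m1 := mrestr P mXA.
pose m2 := mscale (NngNum PAge0) P.
rewrite setIC -[LHS]/(m1 B).
transitivity (m2 B); last by rewrite /m2 /= /mscale /= fineK.
apply: (g_sigma_algebra_measure_unique cylinders_off _ (fun=> setT)) => //.
- exact: measurable_cylinders_off.
- by move=> _; exact: cylinders_offT.
- by rewrite bigcup_const.
- exact: setI_closed_cylinders_off.
- move=> C GC; rewrite /m1 /= /mrestr setIC indep_cylinders_off//.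
  by rewrite /m2 /mscale /= fineK.
- by move=> _; rewrite /m1 /= /mrestr setTI ltey_eq PAfin.
Qed.

Definition off_RV : {RV P >-> off_type} := mfun_of measurable_off_id.

End OneVsRest.

(** * Random variables with all moments *)

Lemma normrXD_le (R : realType) (x y : R) p :
  `|x + y| ^+ p <= 2 ^+ p * (`|x| ^+ p + `|y| ^+ p).
Proof.
pose m := Num.max `|x| `|y|.
have m0 : 0 <= m by rewrite /m le_max normr_ge0.
have xym : `|x + y| <= 2 * m.
  rewrite (le_trans (ler_normD _ _))// mulrDl mul1r lerD// /m le_max lexx//.
  by rewrite orbT.
apply: (@le_trans _ _ ((2 * m) ^+ p)); first by rewrite lerXn2r// nnegrE mulr_ge0.
rewrite exprMn ler_wpM2l ?exprn_ge0// /m /Num.max; case: ifP => _.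
  by rewrite lerDr exprn_ge0.
by rewrite lerDl exprn_ge0.
Qed.

(** From [a * b <= a ^+ 2 + b ^+ 2]. The doubled exponent is harmless when all moments are finite,
    and the bound stands in for Cauchy-Schwarz. *)
Lemma normrXM_le (R : realType) (x y : R) p :
  `|x * y| ^+ p <= `|x| ^+ (p * 2) + `|y| ^+ (p * 2).
Proof.
rewrite normrM exprMn !exprM.
have := sqr_ge0 (`|x| ^+ p - `|y| ^+ p).
have := sqr_ge0 (`|x| ^+ p); have := sqr_ge0 (`|y| ^+ p).
nra.
Qed.

Lemma expr_le1D (R : realType) (t : R) p q : 0 <= t -> (p <= q)%N ->
  t ^+ p <= 1 + t ^+ q.
Proof.
move=> t0 pq; have [t1|t1] := leP t 1.
  by rewrite (le_trans (exprn_ile1 _ _ t1))// lerDl exprn_ge0.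
by rewrite (le_trans (ler_weXn2l (ltW t1) pq))// lerDr.
Qed.

Section AllMoments.
Context d (T : measurableType d) (R : realType) (P : probability T R).
Implicit Types f g : T -> R.

(** This class is closed under sums, products and powers, so integrability of any polynomial in such
    variables follows from closure. *)
Definition all_moments f := measurable_fun setT f /\
  forall p, P.-integrable setT (EFin \o (fun w => `|f w| ^+ p)).

(** [fine] sends an infinite integral to 0; under [all_moments] nothing is lost, see
    [mean_integral]. *)
Definition mean f : R := fine (\int[P]_w (f w)%:E)%E.

Lemma measurable_normX f p : measurable_fun setT f ->
  measurable_fun setT (fun w => `|f w| ^+ p).
Proof.
by move=> mf; apply: measurable_funX; exact: measurableT_comp.
Qed.

Lemma integrable_bounded f g :
  measurable_fun setT f -> (forall w, `|f w| <= g w) ->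
  P.-integrable setT (EFin \o g) -> P.-integrable setT (EFin \o f).
Proof.
move=> mf fg; apply: le_integrable => //; first exact/measurable_EFinP.
by move=> w _ /=; rewrite lee_fin (le_trans (fg w))// ler_norm.
Qed.

Lemma all_moments_integrable f : all_moments f ->
  P.-integrable setT (EFin \o f).
Proof.
by move=> [mf /(_ 1%N)]; apply: integrable_bounded => // w; rewrite expr1.
Qed.

(** The power p is dominated by [1 + t ^+ (p + 3)], so bounds from order 3 on control the lower
    orders too. *)
Lemma all_momentsW f : measurable_fun setT f ->
  (forall p, (3 <= p)%N ->
    (\int[P]_w (`|f w| ^+ p)%:E < +oo)%E) -> all_moments f.
Proof.
move=> mf fp; split=> // p.
apply: (@integrable_bounded _ (fun w => 1 + `|f w| ^+ (p + 3))).
- exact: measurable_normX.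
- by move=> w; rewrite ger0_norm ?exprn_ge0// expr_le1D// leq_addr.
have -> : EFin \o (fun w => 1 + `|f w| ^+ (p + 3)) =
  (cst 1%E \+ (EFin \o (fun w => (`|f w| ^+ (p + 3))%R)))%E by [].
apply: integrableD => //; first exact: finite_measure_integrable_cst.
apply/integrableP; split; first by apply/measurable_EFinP; exact: measurable_normX.
rewrite (eq_integral (fun w => (`|f w| ^+ (p + 3))%:E)).
  by apply: fp; rewrite leq_addl.
by move=> w _; rewrite /= ger0_norm// exprn_ge0.
Qed.

Lemma all_moments_cst c : all_moments (fun=> c).
Proof.
by split=> // p; exact: finite_measure_integrable_cst.
Qed.

Lemma all_momentsD f g : all_moments f -> all_moments g ->
  all_moments (fun w => f w + g w).
Proof.
move=> [mf If] [mg Ig]; split=> [|p]; first exact: measurable_funD.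
apply: (@integrable_bounded _
    (fun w => 2 ^+ p * (`|f w| ^+ p + `|g w| ^+ p))).
- by apply: measurable_normX; exact: measurable_funD.
- by move=> w; rewrite ger0_norm ?exprn_ge0// normrXD_le.
have -> : EFin \o (fun w => 2 ^+ p * (`|f w| ^+ p + `|g w| ^+ p)) =
  (fun w => (2 ^+ p)%:E * ((EFin \o (fun w => (`|f w| ^+ p)%R)) \+
                           (EFin \o (fun w => (`|g w| ^+ p)%R))) w)%E by [].
by apply: integrableZl => //; exact: integrableD.
Qed.

Lemma all_momentsM f g : all_moments f -> all_moments g ->
  all_moments (fun w => f w * g w).
Proof.
move=> [mf If] [mg Ig]; split=> [|p]; first exact: measurable_funM.
apply: (@integrable_bounded _
    (fun w => `|f w| ^+ (p * 2) + `|g w| ^+ (p * 2))).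
- by apply: measurable_normX; exact: measurable_funM.
- by move=> w; rewrite ger0_norm ?exprn_ge0// normrXM_le.
have -> : EFin \o (fun w => `|f w| ^+ (p * 2) + `|g w| ^+ (p * 2)) =
  ((EFin \o (fun w => (`|f w| ^+ (p * 2))%R)) \+
   (EFin \o (fun w => (`|g w| ^+ (p * 2))%R)))%E by [].
exact: integrableD.
Qed.

Lemma all_momentsZ c f : all_moments f -> all_moments (fun w => c * f w).
Proof. by move=> Mf; apply: all_momentsM => //; exact: all_moments_cst. Qed.

Lemma all_momentsN f : all_moments f -> all_moments (fun w => - f w).
Proof.
move=> /(all_momentsZ (-1)); congr all_moments.
by apply/funext => w; rewrite mulN1r.
Qed.

Lemma all_momentsB f g : all_moments f -> all_moments g ->
  all_moments (fun w => f w - g w).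
Proof. by move=> Mf Mg; apply: all_momentsD => //; exact: all_momentsN. Qed.

Lemma all_moments_sum I (r : seq I) (Q : pred I) (F : I -> T -> R) :
  (forall i, Q i -> all_moments (F i)) ->
  all_moments (fun w => \sum_(i <- r | Q i) F i w).
Proof.
move=> MF; elim: r => [|i r IH].
  rewrite (_ : (fun w => _) = (fun=> 0)); first exact: all_moments_cst.
  by apply/funext => w; rewrite big_nil.
have [Qi|Qi] := boolP (Q i); last first.
  rewrite (_ : (fun w => _) = (fun w => \sum_(i <- r | Q i) F i w))//.
  by apply/funext => w; rewrite big_cons (negbTE Qi).
rewrite (_ : (fun w => _) = (fun w => F i w + \sum_(i <- r | Q i) F i w)).
  by apply: all_momentsD => //; exact: MF.
by apply/funext => w; rewrite big_cons Qi.
Qed.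

Lemma all_moments_prod I (r : seq I) (Q : pred I) (F : I -> T -> R) :
  (forall i, Q i -> all_moments (F i)) ->
  all_moments (fun w => \prod_(i <- r | Q i) F i w).
Proof.
move=> MF; elim: r => [|i r IH].
  rewrite (_ : (fun w => _) = (fun=> 1)); first exact: all_moments_cst.
  by apply/funext => w; rewrite big_nil.
have [Qi|Qi] := boolP (Q i); last first.
  rewrite (_ : (fun w => _) = (fun w => \prod_(i <- r | Q i) F i w))//.
  by apply/funext => w; rewrite big_cons (negbTE Qi).
rewrite (_ : (fun w => _) = (fun w => F i w * \prod_(i <- r | Q i) F i w)).
  by apply: all_momentsM => //; exact: MF.
by apply/funext => w; rewrite big_cons Qi.
Qed.

Lemma all_momentsX f p : all_moments f -> all_moments (fun w => f w ^+ p).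
Proof.
move=> Mf; elim: p => [|p IH].
  rewrite (_ : (fun w => _) = (fun=> 1)); first exact: all_moments_cst.
  by apply/funext => w; rewrite expr0.
rewrite (_ : (fun w => _) = (fun w => f w * f w ^+ p)).
  exact: all_momentsM.
by apply/funext => w; rewrite exprS.
Qed.

Lemma all_moments_norm f : all_moments f -> all_moments (fun w => `|f w|).
Proof.
move=> [mf If]; split=> [|p]; first exact: measurableT_comp.
by have := If p; congr integrable; apply/funext => w /=; rewrite normr_id.
Qed.

Lemma mean_integral f : all_moments f ->
  (\int[P]_w (f w)%:E = (mean f)%:E)%E.
Proof.
move=> /all_moments_integrable If.
by rewrite /mean fineK//; exact: integrable_fin_num If.
Qed.

Lemma mean_cst c : mean (fun=> c) = c.
Proof. rewrite /mean; have -> : (\int[P]_w c%:E = c%:E * P setT)%E by exact: integral_cst.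
by rewrite probability_setT mule1. Qed.

Lemma meanD f g : all_moments f -> all_moments g ->
  mean (fun w => f w + g w) = mean f + mean g.
Proof.
move=> Mf Mg; apply: EFin_inj; rewrite EFinD -!mean_integral//; last first.
  exact: all_momentsD.
by rewrite integralD_EFin//; exact: all_moments_integrable.
Qed.

Lemma meanZ c f : all_moments f -> mean (fun w => c * f w) = c * mean f.
Proof.
move=> Mf; apply: EFin_inj; rewrite EFinM -!mean_integral//; last first.
  exact: all_momentsZ.
by rewrite -integralZl//; exact: all_moments_integrable.
Qed.

Lemma meanN f : all_moments f -> mean (fun w => - f w) = - mean f.
Proof.
move=> Mf; rewrite -mulN1r -meanZ//.
by congr mean; apply/funext => w; rewrite mulN1r.
Qed.

Lemma meanB f g : all_moments f -> all_moments g ->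
  mean (fun w => f w - g w) = mean f - mean g.
Proof. by move=> Mf Mg; rewrite meanD// ?meanN//; exact: all_momentsN. Qed.

Lemma mean_sum I (r : seq I) (Q : pred I) (F : I -> T -> R) :
  (forall i, Q i -> all_moments (F i)) ->
  mean (fun w => \sum_(i <- r | Q i) F i w) = \sum_(i <- r | Q i) mean (F i).
Proof.
move=> MF; elim: r => [|i r IH].
  rewrite big_nil -[RHS](mean_cst 0); congr mean.
  by apply/funext => w; rewrite big_nil.
rewrite big_cons; case: ifPn => Qi; last first.
  by rewrite -IH; congr mean; apply/funext => w; rewrite big_cons (negbTE Qi).
rewrite -IH -meanD; [|exact: MF|exact: all_moments_sum].
by congr mean; apply/funext => w; rewrite big_cons Qi.
Qed.

Lemma le_mean f g : all_moments f -> all_moments g ->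
  (forall w, f w <= g w) -> mean f <= mean g.
Proof.
move=> Mf Mg fg; rewrite -lee_fin -!mean_integral//.
apply: le_integral => //; [exact: all_moments_integrable..|].
by move=> w _; rewrite lee_fin.
Qed.

Lemma normr_mean f : all_moments f -> `|mean f| <= mean (fun w => `|f w|).
Proof.
move=> Mf; have Mn := all_moments_norm Mf.
rewrite ler_norml; apply/andP; split.
  rewrite -meanN//; apply: le_mean => //; first exact: all_momentsN.
  by move=> w; rewrite lerNl -normrN ler_norm.
by apply: le_mean => // w; exact: ler_norm.
Qed.

Lemma mean_ge0 f : (forall w, 0 <= f w) -> 0 <= mean f.
Proof. by move=> f0; rewrite /mean fine_ge0// integral_ge0// => w _; rewrite lee_fin. Qed.

End AllMoments.

Section TransferMoments.
Context d d' (T : measurableType d) (E : measurableType d') (R : realType)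
  (P : probability T R) (Y : {RV P >-> E}).

Lemma all_moments_distribution (f : E -> R) :
  measurable_fun setT f ->
  all_moments P (f \o Y) <-> all_moments (distribution P Y) f.
Proof.
move=> mf.
have mfp p : measurable_fun setT (EFin \o (fun w => `|f w| ^+ p)).
  by apply/measurable_EFinP; exact: measurable_normX.
have mfYp p : measurable_fun setT (EFin \o (fun w => `|(f \o Y) w| ^+ p)).
  by apply/measurable_EFinP; apply: measurable_normX; exact: measurableT_comp.
have intE p : (\int[distribution P Y]_y `|(EFin \o (fun w => `|f w| ^+ p)%R) y| =
    \int[P]_w `|(EFin \o (fun w => `|(f \o Y) w| ^+ p)%R) w|)%E.
  by rewrite ge0_integral_distribution//; exact: measurableT_comp.
split=> -[_ If]; split=> //.
- by move=> p; apply/integrableP; split; rewrite // intE; case/integrableP: (If p).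
- exact: measurableT_comp.
- by move=> p; apply/integrableP; split; rewrite // -intE; case/integrableP: (If p).
Qed.

Lemma mean_distribution (f : E -> R) : all_moments (distribution P Y) f ->
  mean (distribution P Y) f = mean P (f \o Y).
Proof.
move=> Mf; rewrite /mean integral_distribution//.
  by apply/measurable_EFinP; case: Mf.
by apply: all_moments_integrable; apply/all_moments_distribution=> //; case: Mf.
Qed.

End TransferMoments.

(** A power lies above its tangent at [t]: the inductive step leaves the remainder
    [n.+1%:R * t ^+ n * (a - t) ^+ 2]. This serves Jensen's inequality, the sums of powers and the
    passage from [n.-1] to [n]. *)
Lemma expr_tangent (R : realFieldType) (a t : R) n : 0 <= a -> 0 <= t ->
  t ^+ n.+1 + n.+1%:R * t ^+ n * (a - t) <= a ^+ n.+1.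
Proof.
move=> a0 t0; elim: n => [|n IH]; first by rewrite expr0 !expr1; lra.
have tn : 0 <= t ^+ n by rewrite exprn_ge0.
apply: (@le_trans _ _ (a * (t ^+ n.+1 + n.+1%:R * t ^+ n * (a - t)))); last first.
  by rewrite [leRHS]exprS ler_wpM2l.
rewrite -subr_ge0 (_ : _ - _ = n.+1%:R * t ^+ n * (a - t) ^+ 2).
  by apply: mulr_ge0; [rewrite mulr_ge0|exact: sqr_ge0].
by rewrite !exprS -[n.+2]addn1 natrD; ring.
Qed.

Section MeanJensen.
Context d (T : measurableType d) (R : realType) (mu : probability T R).

(** Jensen, by integrating the tangent at the absolute mean of [f]. Integrability of [f] is not
    assumed: an infinite right side is trivial and a finite one forces it. The bound thus applies to
    every section of the kernel. *)
Lemma normr_mean_expr_le (f : T -> R) p : measurable_fun setT f ->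
  ((`|mean mu f| ^+ p.+1)%:E <= \int[mu]_x (`|f x| ^+ p.+1)%:E)%E.
Proof.
move=> mf.
have mfp q : measurable_fun setT (EFin \o (fun x => `|f x| ^+ q)).
  by apply/measurable_EFinP; exact: measurable_normX.
have [foo|] := eqVneq (\int[mu]_x (`|f x| ^+ p.+1)%:E)%E +oo%E.
  by rewrite foo leey.
rewrite -ltey => fp.
have ifp : mu.-integrable setT (EFin \o (fun x => `|f x| ^+ p.+1)).
  apply/integrableP; split=> //.
  rewrite (eq_integral (fun w => (`|f w| ^+ p.+1)%:E))//.
  by move=> w _; rewrite /= ger0_norm// exprn_ge0.
have i1 : mu.-integrable setT (EFin \o (fun x : T => 1 : R)).
  exact: finite_measure_integrable_cst.
have iF : mu.-integrable setT (EFin \o f).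
  apply: (@integrable_bounded _ _ _ _ _ (fun x => 1 + `|f x| ^+ p.+1)) => //.
    by move=> x; rewrite -[leLHS]expr1 expr_le1D.
  exact: (integrableD _ i1 ifp).
have inf : mu.-integrable setT (EFin \o (fun x => `|f x|)).
  exact: (integrable_norm iF).
set t := `|mean mu f|.
have t0 : 0 <= t by rewrite /t.
have tle : (t%:E <= \int[mu]_x (`|f x|)%:E)%E.
  apply: le_trans (le_abse_integral mu measurableT (measurable_int _ iF)).
  have := integrable_fin_num measurableT iF.
  rewrite /t /mean; case: (\int[mu]_x _)%E => //.
pose b := p.+1%:R * t ^+ p.
have b0 : 0 <= b by rewrite /b mulr_ge0// exprn_ge0.
have ilow : mu.-integrable setT (EFin \o (fun x => (t ^+ p.+1 - b * t) + b * `|f x|)).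
  apply: (@integrableD _ _ _ _ _ measurableT
    (EFin \o (fun=> t ^+ p.+1 - b * t)) (EFin \o (fun x => b * `|f x|))).
    exact: finite_measure_integrable_cst.
  exact: (integrableZl _ b inf).
apply: (@le_trans _ _ (\int[mu]_x ((t ^+ p.+1 - b * t) + b * `|f x|)%:E)%E).
  rewrite (@integralD_EFin _ _ _ _ _ measurableT
    (fun=> t ^+ p.+1 - b * t) (fun x => b * `|f x|))//; last 2 first.
  - exact: finite_measure_integrable_cst.
  - exact: (integrableZl _ b inf).
  rewrite (integral_cst mu measurableT (t ^+ p.+1 - b * t)%:E).
  rewrite (_ : (\int[mu]_x (b * `|f x|)%:E = b%:E * \int[mu]_x (`|f x|)%:E)%E).
    have := @probability_setT _ _ _ mu.
    move=> /= ->; rewrite mule1.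
    apply: (@le_trans _ _ ((t ^+ p.+1 - b * t)%:E + b%:E * t%:E)%E).
      by rewrite -EFinM -EFinD subrK.
    by rewrite leeD2l// lee_wpmul2l// lee_fin.
  by rewrite -integralZl.
apply: le_integral => // x _; rewrite lee_fin.
have := expr_tangent p (normr_ge0 (f x)) t0.
by apply: le_trans; rewrite -/b le_eqVlt; apply/orP; left; apply/eqP; ring.
Qed.

End MeanJensen.

(** * Hoeffding projections *)

Section HoeffdingProjection.
Context d (E : measurableType d) (R : realType) (mu : probability E R).
Variable h : E * E -> R.
Hypothesis h_sym : forall x y : E, h (x, y) = h (y, x).
Hypothesis h_moments : all_moments (mu \x mu)%E h.

(** [kernel_mean], [hoeffding1] and [hoeffding2] are theta, g1 and g2. Where the section at [x] is
    not integrable, [kernel_proj x] is 0, the default value of [fine]. *)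
Definition kernel_proj (x : E) : R := mean mu (fun y => h (x, y)).
Definition kernel_mean : R := mean mu kernel_proj.
Definition hoeffding1 (x : E) : R := kernel_proj x - kernel_mean.
Definition hoeffding2 (x y : E) : R := h (x, y) - kernel_proj x - kernel_proj y + kernel_mean.

Let mh : measurable_fun setT h. Proof. by case: h_moments. Qed.

Lemma measurable_section x : measurable_fun setT (fun y => h (x, y)).
Proof. exact: measurableT_comp. Qed.

Lemma measurable_kernel_proj : measurable_fun setT kernel_proj.
Proof.
have ih := all_moments_integrable h_moments.
apply: (measurableT_comp (f := fine)) => //.
exact: (measurable_fubini_F ih).
Qed.

(** Jensen on each section, then Tonelli: an absolute moment of the projection is at most that of
    [h]. The integrands are non-negative, so exceptional sections do no harm. *)
Lemma all_moments_kernel_proj : all_moments mu kernel_proj.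
Proof.
apply: all_momentsW; first exact: measurable_kernel_proj.
move=> [//|p] _.
have [_ /(_ p.+1) /integrableP[mhp]] := h_moments.
apply: le_lt_trans.
have mhp' : measurable_fun setT (fun z : E * E => (`|h z| ^+ p.+1)%:E).
  by apply/measurable_EFinP; exact: measurable_normX.
have hp0 (z : E * E) : (0 <= (`|h z| ^+ p.+1)%:E)%E.
  by rewrite lee_fin exprn_ge0.
rewrite (eq_integral (fun z => (`|h z| ^+ p.+1)%:E)); last first.
  by move=> w _; rewrite /= ger0_norm// exprn_ge0.
rewrite fubini_tonelli1//.
apply: ge0_le_integral.
- exact: measurableT.
- by move=> x _; rewrite lee_fin exprn_ge0.
- by apply/measurable_EFinP; apply: measurable_normX; exact: measurable_kernel_proj.
- by apply: measurable_fun_fubini_tonelli_F => // z; rewrite lee_fin exprn_ge0.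
- by move=> x _; apply: normr_mean_expr_le; exact: measurable_section.
Qed.

Lemma all_moments_hoeffding1 : all_moments mu hoeffding1.
Proof. by apply: all_momentsB all_moments_kernel_proj _; exact: all_moments_cst. Qed.

Lemma mean_hoeffding1 : mean mu hoeffding1 = 0.
Proof.
rewrite meanB ?mean_cst ?subrr//; first exact: all_moments_kernel_proj.
exact: all_moments_cst.
Qed.

Lemma mean_kernel : mean (mu \x mu)%E h = kernel_mean.
Proof.
have ih := all_moments_integrable h_moments.
rewrite /mean -(integral12_prod_meas1 ih) /kernel_mean /mean.
congr fine; apply: ae_eq_integral => //.
- exact: (measurable_fubini_F ih).
- by apply/measurable_EFinP; exact: measurable_kernel_proj.
apply: filterS (ae_integrable1 ih) => x ix _.
by rewrite /kernel_proj /mean /fubini_F fineK//; exact: (integrable_fin_num measurableT ix).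
Qed.

Lemma hoeffding2C x y : hoeffding2 x y = hoeffding2 y x.
Proof. by rewrite /hoeffding2 h_sym; ring. Qed.

(** Degeneracy of g2, at those [y] whose section is integrable, which is almost all of them. The
    factor [c] leaves room for the other factors of a product, constant while [x] is integrated
    out. *)
Lemma mean_hoeffding2 (c : R) y :
  mu.-integrable setT (fun x => (h (x, y))%:E) ->
  (\int[mu]_x (c * hoeffding2 x y)%:E = 0)%E.
Proof.
move=> ihy.
have ip : mu.-integrable setT (EFin \o kernel_proj).
  exact: all_moments_integrable all_moments_kernel_proj.
have ic : mu.-integrable setT (EFin \o (fun=> kernel_mean - kernel_proj y)).
  exact: finite_measure_integrable_cst.
have ihp : mu.-integrable setT (EFin \o (fun x => h (x, y) - kernel_proj x)).
  exact: (integrableB _ ihy ip).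
have i2 : mu.-integrable setT (EFin \o (hoeffding2^~ y)).
  have -> : EFin \o hoeffding2^~ y = EFin \o (fun x => (h (x, y) - kernel_proj x) + (kernel_mean - kernel_proj y)).
    by apply/funext => x /=; rewrite /hoeffding2; congr EFin; ring.
  exact: (integrableD _ ihp ic).
rewrite (eq_integral (fun x => c%:E * (hoeffding2 x y)%:E)%E)//.
rewrite (integralZl _ i2)//.
rewrite (eq_integral (fun x => ((h (x, y) - kernel_proj x) + (kernel_mean - kernel_proj y))%:E)); last first.
  by move=> x _; rewrite /hoeffding2; congr EFin; ring.
rewrite (integralD_EFin measurableT ihp ic) (integralB_EFin measurableT ihy ip).
rewrite -/kernel_mean.
have -> : (\int[mu]_x (h (x, y))%:E = (kernel_proj y)%:E)%E.
  rewrite /kernel_proj /mean (eq_integral (fun x => (h (y, x))%:E)); last first.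
    by move=> x _; rewrite h_sym.
  rewrite fineK//; apply: (integrable_fin_num measurableT).
  by apply: eq_integrable ihy => // x _; rewrite h_sym.
rewrite (mean_integral all_moments_kernel_proj) -/kernel_mean.
have -> : (\int[mu]_x (kernel_mean - kernel_proj y)%:E = (kernel_mean - kernel_proj y)%:E)%E.
  have -> : (\int[mu]_x (kernel_mean - kernel_proj y)%:E = (kernel_mean - kernel_proj y)%:E * mu setT)%E.
    exact: integral_cst.
  by rewrite probability_setT mule1.
rewrite -!EFinB -EFinD -EFinM; congr EFin; ring.
Qed.

End HoeffdingProjection.

Section EqMeasure.
Context d (T : measurableType d) (R : realType).
Variables (m1 m2 : {measure set T -> \bar R}).
Hypothesis m12 : forall A, measurable A -> m1 A = m2 A.

(** Identical distribution is equality on measurable sets only, so integrability, moments and means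
    are transferred by lemmas rather than by rewriting the measure. *)
Lemma integrable_eq_measure (f : T -> \bar R) :
  m1.-integrable setT f -> m2.-integrable setT f.
Proof.
move=> /integrableP[mf fi]; apply/integrableP; split=> //.
by rewrite (eq_measure_integral m1)// => A mA _; rewrite m12.
Qed.

End EqMeasure.

Section EqProbability.
Context d (T : measurableType d) (R : realType).
Variables (P1 P2 : probability T R).
Hypothesis P12 : forall A, measurable A -> P1 A = P2 A.

Lemma all_moments_eq_measure (f : T -> R) : all_moments P1 f -> all_moments P2 f.
Proof.
by move=> [mf If]; split=> // p; apply: integrable_eq_measure (If p).
Qed.

Lemma mean_eq_measure (f : T -> R) : mean P1 f = mean P2 f.
Proof.
by rewrite /mean; congr fine; apply: eq_measure_integral => A mA _; exact: P12.
Qed.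

End EqProbability.

Section IndependentProduct.
Context d d1 d2 (T : measurableType d) (T1 : measurableType d1)
  (T2 : measurableType d2) (R : realType) (P : probability T R).
Variables (Y : {RV P >-> T1}) (Z : {RV P >-> T2}).
Hypothesis YZ_indep : forall A B, measurable A -> measurable B ->
  P (Y @^-1` A `&` Z @^-1` B) = (P (Y @^-1` A) * P (Z @^-1` B))%E.

Lemma mean_indepM (f : T1 -> R) (g : T2 -> R) :
  measurable_fun setT f -> measurable_fun setT g ->
  all_moments P (f \o Y) -> all_moments P (g \o Z) ->
  mean P (fun w => f (Y w) * g (Z w)) = mean P (f \o Y) * mean P (g \o Z).
Proof.
move=> mf mg Mf Mg.
have Mf' : all_moments (distribution P Y) f by apply/all_moments_distribution.
have Mg' : all_moments (distribution P Z) g by apply/all_moments_distribution.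
have mF : measurable_fun [set: T1 * T2] (fun z => (f z.1 * g z.2)%:E).
  apply/measurable_EFinP; apply: measurable_funM.
  - exact: (measurableT_comp mf).
  - exact: (measurableT_comp mg).
have iF : P.-integrable setT (fun w => (f (Y w) * g (Z w))%:E).
  by apply: all_moments_integrable; exact: all_momentsM.
apply: EFin_inj; rewrite -mean_integral; last exact: all_momentsM.
rewrite (integral_indep_pair YZ_indep mF iF) /=.
rewrite (eq_integral (fun z => (mean P (f \o Y))%:E * (g z)%:E)%E); last first.
  move=> z _.
  rewrite (eq_integral (fun y => (g z)%:E * (f y)%:E)%E); last first.
    by move=> y _; rewrite mulrC.
  rewrite integralZl//; last exact: all_moments_integrable.
  by rewrite (mean_integral Mf') mean_distribution// muleC.
rewrite integralZl//; last exact: all_moments_integrable.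
by rewrite (mean_integral Mg') [in LHS]mean_distribution.
Qed.

End IndependentProduct.

(** The product is at most the power of its largest factor, and that power is one term of the sum.
    This stands in for Hoelder's inequality on mixed moments. *)
Lemma prod_le_sum_expr (R : realDomainType) n (y : 'I_n.+1 -> R) :
  (forall i, 0 <= y i) -> \prod_i y i <= \sum_i y i ^+ n.+1.
Proof.
move=> y0; pose m := [arg max_(i > ord0) y i]%O.
have ym i : y i <= y m.
  by rewrite /m; case: arg_maxP => // j _ /(_ i isT).
apply: (@le_trans _ _ (y m ^+ n.+1)).
  rewrite -[X in _ ^+ X]card_ord -prodr_const.
  by apply: ler_prod => i _; rewrite y0 ym.
by rewrite (bigD1 m)//= lerDl sumr_ge0// => i _; rewrite exprn_ge0.
Qed.

(** * Mixed moments of the Hoeffding terms *)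

Section HoeffdingTerms.
Context d d' (T : measurableType d) (E : measurableType d') (R : realType)
  (P : probability T R).
Variables (X : nat -> {RV P >-> E}) (h : E * E -> R).
Hypothesis X_iid : iid X.
Hypothesis h_meas : measurable_fun setT h.
Hypothesis h_sym : forall x y : E, h (x, y) = h (y, x).
Hypothesis h01_moments : all_moments P (fun w => h (X 0%N w, X 1%N w)).

Let mu := distribution P (X 0%N).

Lemma distribution_iid i A : measurable A -> distribution P (X i) A = mu A.
Proof. by move=> mA; case: X_iid => _; apply. Qed.

Lemma indep_pair i j (A B : set E) : i != j -> measurable A -> measurable B ->
  P (X i @^-1` A `&` X j @^-1` B) = (P (X i @^-1` A) * P (X j @^-1` B))%E.
Proof.
move=> ij mA mB; case: X_iid => X_indep _.
have := X_indep [:: i; j] (fun n => if n == i then A else B).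
rewrite /= inE ij !big_cons !big_nil eqxx eq_sym (negbTE ij) setIT mule1.
by apply => // n; case: ifP.
Qed.

Lemma measurable_pair_RV i j : measurable_fun setT (fun w => (X i w, X j w)).
Proof. by apply/measurable_fun_pairP; split; exact: measurable_funP. Qed.

Definition pair_RV i j : {RV P >-> (E * E)%type} :=
  mfun_of (measurable_pair_RV i j).

Lemma distribution_pair_RV i j C : i != j -> measurable C ->
  (mu \x mu)%E C = distribution P (pair_RV i j) C.
Proof.
move=> ij mC; apply: product_measure_unique => // A B mA mB.
transitivity (distribution P (X i) A * distribution P (X j) B)%E.
  exact: indep_pair.
by rewrite !distribution_iid.
Qed.

Lemma h_moments : all_moments (mu \x mu)%E h.
Proof.
apply: (@all_moments_eq_measure _ _ _ (distribution P (pair_RV 0 1))).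
  by move=> A mA; exact/esym/distribution_pair_RV.
exact/(all_moments_distribution (pair_RV 0 1)).
Qed.

Lemma all_moments_pair i j (F : E * E -> R) : i != j ->
  all_moments (mu \x mu)%E F -> all_moments P (fun w => F (X i w, X j w)).
Proof.
move=> ij MF; have mF : measurable_fun setT F by case: MF.
apply/(all_moments_distribution (pair_RV i j) mF).
apply: (@all_moments_eq_measure _ _ _ (mu \x mu)%E) => //.
by move=> A mA; exact: distribution_pair_RV.
Qed.

Lemma mean_pair i j (F : E * E -> R) : i != j ->
  all_moments (mu \x mu)%E F ->
  mean P (fun w => F (X i w, X j w)) = mean (mu \x mu)%E F.
Proof.
move=> ij MF; have mF : measurable_fun setT F by case: MF.
have MF' := all_moments_pair ij MF.
rewrite -[LHS](@mean_distribution _ _ _ _ _ P (pair_RV i j) F); last first.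
  exact/all_moments_distribution.
by apply: mean_eq_measure => A mA; exact/esym/distribution_pair_RV.
Qed.

Lemma all_moments_X i (f : E -> R) :
  all_moments mu f -> all_moments P (fun w => f (X i w)).
Proof.
move=> Mf; have mf : measurable_fun setT f by case: Mf.
apply/(all_moments_distribution (X i) mf).
apply: (@all_moments_eq_measure _ _ _ mu) => //.
by move=> A mA; exact/esym/distribution_iid.
Qed.

Lemma mean_X i (f : E -> R) :
  all_moments mu f -> mean P (fun w => f (X i w)) = mean mu f.
Proof.
move=> Mf; have mf : measurable_fun setT f by case: Mf.
rewrite -[LHS](@mean_distribution _ _ _ _ _ P (X i) f); last first.
  by apply/all_moments_distribution=> //; exact: all_moments_X.
by apply: mean_eq_measure => A mA; exact: distribution_iid.
Qed.

Let G1 := hoeffding1 mu h.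
Let G2 := hoeffding2 mu h.

Lemma measurable_hoeffding1_comp d2 (T2 : measurableType d2) (u : T2 -> E) :
  measurable_fun setT u -> measurable_fun setT (fun z => G1 (u z)).
Proof.
by move=> mu'; apply: measurableT_comp => //; case: (all_moments_hoeffding1 h_moments).
Qed.

Lemma measurable_hoeffding2_comp d2 (T2 : measurableType d2) (u1 u2 : T2 -> E) :
  measurable_fun setT u1 -> measurable_fun setT u2 ->
  measurable_fun setT (fun z => G2 (u1 z) (u2 z)).
Proof.
move=> m1 m2; have mp := measurable_kernel_proj h_moments.
apply: measurable_funD => //; apply: measurable_funB.
  apply: measurable_funB; last exact: measurableT_comp.
  apply: (measurableT_comp h_meas); exact: measurable_fun_pair.
exact: measurableT_comp.
Qed.

Lemma all_moments_hoeffding1X i : all_moments P (fun w => G1 (X i w)).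
Proof. exact: all_moments_X (all_moments_hoeffding1 h_moments). Qed.

Lemma all_moments_hoeffding2X i j : i != j -> all_moments P (fun w => G2 (X i w) (X j w)).
Proof.
move=> ij; have Mp k := all_moments_X k (all_moments_kernel_proj h_moments).
apply: all_momentsD; last exact: all_moments_cst.
apply: all_momentsB (Mp j); apply: all_momentsB (Mp i).
exact: all_moments_pair h_moments.
Qed.

(** Pairs with [p.1 > p.2] get 0, so that sums may range over all pairs. The argument is a whole
    sequence [u] rather than a sample point, so that one coordinate can be replaced while the others
    are kept. *)
Definition factor (p : nat * nat) (u : nat -> E) : R :=
  if p.1 == p.2 then G1 (u p.1)
  else if (p.1 < p.2)%N then G2 (u p.1) (u p.2) else 0.

Lemma measurable_factor d2 (T2 : measurableType d2) (u : T2 -> nat -> E) p :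
  (forall i, measurable_fun setT (u^~ i)) ->
  measurable_fun setT (fun z => factor p (u z)).
Proof.
move=> mu'; rewrite /factor; case: (p.1 == p.2); first exact: measurable_hoeffding1_comp.
by case: (p.1 < p.2)%N => //; exact: measurable_hoeffding2_comp.
Qed.

Lemma all_moments_factor p : all_moments P (fun w => factor p (X^~ w)).
Proof.
rewrite /factor; case: (eqVneq p.1 p.2) => pp; first exact: all_moments_hoeffding1X.
case: (p.1 < p.2)%N; last exact: all_moments_cst.
exact: all_moments_hoeffding2X.
Qed.

(** With all variables but [X v] frozen, only the factor at [a0] moves, and its integral over [X v]
    is 0: by centering of g1 for a loop, and for a pair i < j by degeneracy of g2, at almost all
    values of the other variables. *)
Lemma mean_prod_factor0 (I : finType) (t : I -> nat * nat) (a0 : I) v :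
  ((t a0).1 == v) || ((t a0).2 == v) ->
  (forall a, a != a0 -> ((t a).1 != v) && ((t a).2 != v)) ->
  mean P (fun w => \prod_a factor (t a) (X^~ w)) = 0.
Proof.
move=> va0 vt; have [X_indep _] := X_iid.
pose Z := off_RV X v.
(* The sequence rebuilt from a free value at [v] and the actual values elsewhere. *)
pose upd (z : E * off_type X v) (i : nat) : E := if i == v then z.1 else X i z.2.
pose F z := (\prod_a factor (t a) (upd z))%:E.
have mupd i : measurable_fun setT (upd^~ i).
  rewrite /upd; have [_|iv] := eqVneq i v; first exact: measurable_fst.
  apply: (measurableT_comp (f := X i : off_type X v -> E)).
    exact: measurable_off_X.
  exact: measurable_snd.
have mF : measurable_fun setT F.
  apply/measurable_EFinP; apply: measurable_prod => a _.
  exact: measurable_factor.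
have updX w : upd (X v w, Z w) = X^~ w.
  by apply/funext => i; rewrite /upd; case: eqVneq => [->|].
have MF : all_moments P (fun w => \prod_a factor (t a) (X^~ w)).
  by apply: all_moments_prod => a _; exact: all_moments_factor.
have iF : P.-integrable setT (fun w => F (X v w, Z w)).
  have := all_moments_integrable MF; congr integrable.
  by apply/funext => w; rewrite /F updX.
apply: EFin_inj; rewrite -mean_integral//.
rewrite (eq_integral (fun w => F (X v w, Z w))); last first.
  by move=> w _; rewrite /F updX.
have vZ_indep A B : measurable A -> measurable B ->
    P (X v @^-1` A `&` Z @^-1` B) = (P (X v @^-1` A) * P (Z @^-1` B))%E.
  exact: indep_off.
apply: (integral_indep_pair0 vZ_indep mF iF).
pose c (w : off_type X v) := \prod_(a | a != a0) factor (t a) (X^~ w).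
have FE x w : F (x, w) = (c w * factor (t a0) (upd (x, w)))%:E.
  rewrite /F (bigD1 a0)//= mulrC; congr (_ * _)%:E; apply: eq_bigr => a aa0.
  have /andP[n1 n2] := vt _ aa0.
  by rewrite /factor /upd (negbTE n1) (negbTE n2).
have intv f : (\int[distribution P (X v)]_y f y = \int[mu]_y f y)%E.
  by apply: eq_measure_integral => A mA _; exact: distribution_iid.
have hoeffding2_ae j : j != v -> {ae distribution P Z, forall w,
    (\int[mu]_x (c w * G2 x (X j w))%:E = 0)%E}.
  move=> jv; have mG : measurable_fun [set: E * off_type X v]
      (fun z => (h (z.1, X j z.2))%:E).
    apply/measurable_EFinP/(measurableT_comp h_meas).
    apply: measurable_fun_pair => //.
    apply: (measurableT_comp (f := X j : off_type X v -> E)).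
      exact: measurable_off_X.
    exact: measurable_snd.
  have iG : P.-integrable setT (fun w => (h (X v w, X j (Z w)))%:E).
    apply: all_moments_integrable.
    by apply: (all_moments_pair _ h_moments); rewrite eq_sym.
  apply: filterS (ae_integrable_indep_pair vZ_indep mG iG) => w iw.
  apply: (mean_hoeffding2 h_sym h_moments).
  by apply: integrable_eq_measure iw => A mA; exact: distribution_iid.
move: va0 FE; rewrite /factor; case: (t a0) => i j /=.
have [<-|ij] := eqVneq i j.
  rewrite orbb => /eqP -> FE; apply: aeW => w; rewrite intv.
  under eq_integral do rewrite FE /upd eqxx /=.
  have M1 := all_moments_hoeffding1 h_moments.
  rewrite (mean_integral (all_momentsZ (c w) M1)) meanZ//.
  by rewrite (mean_hoeffding1 h_moments) mulr0.
case: (i < j)%N; last first.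
  move=> _ FE; apply: aeW => w; rewrite intv.
  by under eq_integral do rewrite FE mulr0; rewrite integral0.
move=> /orP[] /eqP vE; rewrite {}vE in ij * => FE.
- apply: filterS (hoeffding2_ae j _) => [w <-|]; last by rewrite eq_sym.
  rewrite intv; apply: eq_integral => x _.
  by rewrite FE /upd eqxx eq_sym (negbTE ij).
- apply: filterS (hoeffding2_ae i ij) => w <-.
  rewrite intv; apply: eq_integral => x _.
  by rewrite FE /upd eqxx (negbTE ij) /= -/G2 /G2 (hoeffding2C mu h_sym).
Qed.

(** One bound for all products of k factors, whatever their indices: by [prod_le_sum_expr] each
    factor contributes at most the two k-th absolute moments together. *)
Definition factor_bound k : R := k%:R *
  (mean mu (fun x => `|G1 x| ^+ k) + mean P (fun w => `|G2 (X 0%N w) (X 1%N w)| ^+ k)).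

Lemma mean_factor_le p k : mean P (fun w => `|factor p (X^~ w)| ^+ k.+1) <=
  mean mu (fun x => `|G1 x| ^+ k.+1) +
  mean P (fun w => `|G2 (X 0%N w) (X 1%N w)| ^+ k.+1).
Proof.
have M1 : all_moments mu (fun x => `|G1 x| ^+ k.+1).
  apply: all_momentsX; apply: all_moments_norm; exact: all_moments_hoeffding1 h_moments.
have B1 : 0 <= mean mu (fun x => `|G1 x| ^+ k.+1).
  by apply: mean_ge0 => x; rewrite exprn_ge0.
have B2 : 0 <= mean P (fun w => `|G2 (X 0%N w) (X 1%N w)| ^+ k.+1).
  by apply: mean_ge0 => x; rewrite exprn_ge0.
rewrite /factor; case: (eqVneq p.1 p.2) => pp; first by rewrite (mean_X _ M1) lerDl.
case: (p.1 < p.2)%N; last first.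
  rewrite (_ : (fun w => _) = fun=> 0) ?mean_cst ?addr_ge0//.
  by apply/funext => w; rewrite normr0 expr0n.
have mG : measurable_fun setT (fun z : E * E => `|G2 z.1 z.2| ^+ k.+1).
  by apply: measurable_normX; exact: measurable_hoeffding2_comp.
have MG : all_moments (mu \x mu)%E (fun z : E * E => `|G2 z.1 z.2| ^+ k.+1).
  apply: (@all_moments_eq_measure _ _ _ (distribution P (pair_RV 0 1))).
    by move=> A mA; exact/esym/distribution_pair_RV.
  apply/(all_moments_distribution (pair_RV 0 1)) => //.
  apply: all_momentsX; apply: all_moments_norm; exact: all_moments_hoeffding2X.
have E1 := @mean_pair p.1 p.2 _ _ MG; rewrite E1//.
by rewrite -(@mean_pair 0 1 _ _ MG)// lerDr.
Qed.

Lemma normr_mean_prod_factor k (t : 'I_k.+1 -> nat * nat) :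
  `|mean P (fun w => \prod_a factor (t a) (X^~ w))| <= factor_bound k.+1.
Proof.
have MF : all_moments P (fun w => \prod_a factor (t a) (X^~ w)).
  by apply: all_moments_prod => a _; exact: all_moments_factor.
have MS a : all_moments P (fun w => `|factor (t a) (X^~ w)| ^+ k.+1).
  apply: all_momentsX; apply: all_moments_norm; exact: all_moments_factor.
apply: le_trans (normr_mean MF) _.
apply: (@le_trans _ _ (mean P (fun w => \sum_a `|factor (t a) (X^~ w)| ^+ k.+1))).
  apply: le_mean; first exact: all_moments_norm.
    by apply: all_moments_sum => a _.
  by move=> w; rewrite normr_prod prod_le_sum_expr.
rewrite mean_sum// /factor_bound mulr_natl -[in X in _ <= _ *+ X](card_ord k.+1).
by rewrite -sumr_const; apply: ler_sum => a _; exact: mean_factor_le.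
Qed.

Definition linear_part n (w : T) : R := \sum_(i < n) G1 (X i w).

Lemma all_moments_linear_part n : all_moments P (linear_part n).
Proof. by apply: all_moments_sum => i _; exact: all_moments_hoeffding1X. Qed.

Lemma mean_linear_partX_recr n s :
  mean P (fun w => linear_part n.+1 w ^+ s) =
  \sum_(r < s.+1) 'C(s, r)%:R * mean P (fun w => linear_part n w ^+ (s - r)) *
                  mean mu (fun x => G1 x ^+ r).
Proof.
have M1 := all_moments_hoeffding1 h_moments.
have [X_indep _] := X_iid.
have Mt r : all_moments P (fun w => linear_part n w ^+ (s - r) * G1 (X n w) ^+ r).
  apply: all_momentsM; apply: all_momentsX; first exact: all_moments_linear_part.
  exact: all_moments_hoeffding1X.
transitivity (mean P (fun w => \sum_(r < s.+1)
    'C(s, r)%:R * (linear_part n w ^+ (s - r) * G1 (X n w) ^+ r))).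
  congr mean; apply/funext => w.
  rewrite {1}/linear_part big_ord_recr /= -/(linear_part n w) exprDn.
  by apply: eq_bigr => r _; rewrite mulr_natl.
rewrite mean_sum; last by move=> r _; apply: all_momentsZ; exact: Mt.
apply: eq_bigr => r _; rewrite meanZ// -mulrA; congr (_ * _).
rewrite -(mean_X n); last exact: all_momentsX.
(* [linear_part n] involves only indices below [n], so it is measurable for the variables other than
   [X n]. *)
pose Z := off_RV X n.
have vZ_indep A B : measurable A -> measurable B ->
    P (X n @^-1` A `&` Z @^-1` B) = (P (X n @^-1` A) * P (Z @^-1` B))%E.
  exact: indep_off.
have := @mean_indepM _ _ _ _ _ _ _ _ _ _ vZ_indep (fun x => G1 x ^+ r)
  (fun w => linear_part n w ^+ (s - r)).
rewrite mulrC => <-.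
- by congr mean; apply/funext => w; rewrite mulrC.
- by apply: measurable_funX; case: M1.
- apply: measurable_funX; apply: measurable_sum => i.
  by apply: measurable_hoeffding1_comp; apply: measurable_off_X; rewrite ltn_eqF.
- exact: (all_moments_X _ (all_momentsX r M1)).
- exact: (all_momentsX _ (all_moments_linear_part n)).
Qed.

End HoeffdingTerms.

(** * Counting tuples of pairs *)

Section VertexCounting.
Variables (I : finType) (n : nat).
Implicit Types t : {ffun I -> 'I_n * 'I_n}.

Definition ends (p : 'I_n * 'I_n) : {set 'I_n} := [set p.1; p.2]%SET.

Definition vertices t : {set 'I_n} := (\bigcup_(a : I) ends (t a))%SET.

Lemma card_vertices_le t : (#|vertices t| <= 2 * #|I|)%N.
Proof.
apply: (@leq_trans (\sum_(a : I) #|ends (t a)|)).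
  rewrite /vertices; elim/big_rec2 : _ => [|a m A _ IH]; first by rewrite cards0.
  by rewrite (leq_trans (leq_card_setU _ _))// leq_add2l.
by rewrite mulnC -sum_nat_const leq_sum// => a _; rewrite cards2; case: (_ != _).
Qed.

(** Every pair of such a tuple lies in the square of [A]. *)
Lemma card_vertices_eq_le (A : {set 'I_n}) :
  (#|[pred t | vertices t == A]| <= (#|A| ^ 2) ^ #|I|)%N.
Proof.
rewrite expnS expn1 -cardsX -card_ffun_on; apply/subset_leq_card/fintype.subsetP.
move=> t /eqP tA; apply/ffun_onP => a; rewrite inE -tA.
apply/andP; split; apply/finset.bigcupP; exists a => //; rewrite /ends ?set21 ?set22//.
Qed.

(** There are ['C(n, v)] vertex sets of size v, each carrying at most [(v ^ 2) ^ #|I|] tuples, and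
    ['C(n, v) <= n ^ v] cancels the weight; what remains is free of n. *)
Lemma sum_vertices_le (R : realFieldType) : (0 < n)%N ->
  \sum_t (n%:R ^- #|vertices t| : R) <=
  \sum_(v < (2 * #|I|).+1) ((v ^ 2) ^ #|I|)%:R.
Proof.
move=> n0; have nR0 : 0 < n%:R :> R by rewrite ltr0n.
have cardN (A : {set 'I_n}) : (#|A| < n.+1)%N.
  by rewrite ltnS -[leqRHS]card_ord max_card.
pose N := (2 * #|I|).+1.
have cardV t : (#|vertices t| < N)%N by rewrite ltnS card_vertices_le.
rewrite (partition_big (fun t => Ordinal (cardV t)) xpredT)//=.
apply: ler_sum => v _.
rewrite (partition_big vertices (fun A => #|A| == v)); last first.
  by move=> t /eqP <-.
apply: (@le_trans _ _ (\sum_(A : {set 'I_n} | #|A| == v)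
    ((v ^ 2) ^ #|I|)%:R * n%:R ^- v)).
  apply: ler_sum => A /eqP Av.
  apply: (@le_trans _ _ (\sum_(t : {ffun I -> 'I_n * 'I_n} | vertices t == A) n%:R ^- v)).
    rewrite [leLHS](eq_bigl (fun t => (vertices t == A))); last first.
      move=> t /=; apply/andP/idP => [[]//|/eqP tA].
      by rewrite -val_eqE /= tA Av !eqxx.
    by apply: ler_sum => t /eqP ->; rewrite Av.
  have nv0 : 0 <= n%:R ^- v :> R by rewrite invr_ge0 exprn_ge0// ltW.
  rewrite sumr_const -[leLHS]mulr_natl; apply: ler_wpM2r => //.
  by rewrite ler_nat -Av; exact: card_vertices_eq_le.
rewrite sumr_const -[leLHS]mulr_natl mulrCA ler_piMr//.
have -> : #|[pred A : {set 'I_n} | #|A| == v]| = 'C(n, v).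
  by rewrite -[in RHS](card_ord n) -card_draws; apply: eq_card => A; rewrite !inE.
rewrite ler_pdivrMr ?exprn_gt0// mul1r -natrX ler_nat.
elim: (v : nat) => [|u IH]; first by rewrite bin0.
rewrite expnS; apply: leq_trans (leq_mul (leqnn n) IH).
have := mul_bin_left n u; have := leq_subr u n.
move: ('C(n, u.+1)) ('C(n, u)) => x y; nia.
Qed.

(** Double counting of incidences between vertices and positions. A loop is counted once, since
    [ends] is a set. *)
Lemma sum_card_ends t :
  (\sum_(v in vertices t) #|[set a : I | v \in ends (t a)]%SET| =
   \sum_(a : I) #|ends (t a)|)%N.
Proof.
transitivity (\sum_(v in vertices t) \sum_(a : I | v \in ends (t a)) 1)%N.
  by apply: eq_bigr => v _; rewrite -sum1_card; apply: eq_bigl => a; rewrite inE.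
rewrite (exchange_big_dep xpredT)//=; apply: eq_bigr => a _; rewrite -sum1_card.
apply: eq_bigl => v; rewrite andb_idl// => va.
by apply/finset.bigcupP; exists a.
Qed.

Definition loops t : nat := #|[set a : I | (t a).1 == (t a).2]%SET|.

Lemma sum_card_ends_loops t : (\sum_(a : I) #|ends (t a)| + loops t = 2 * #|I|)%N.
Proof.
rewrite mulnC -sum_nat_const /loops -sum1_card.
rewrite [X in (_ + X)%N]big_mkcond /= -big_split /=.
by apply: eq_bigr => a _; rewrite cards2 inE; case: eqP.
Qed.

(** Write k = #|I|, with l loops and v vertices. If every vertex lies in two positions, then 2v is
    at most the number 2k - l of incidences. Hence l + v <= k + l/2 < k + k/2 because l < k, and for
    even k the last term is the integer [k + k./2]. *)
Lemma loops_vertices_le t : ~~ odd #|I| -> (loops t < #|I|)%N ->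
  (forall v, v \in vertices t ->
     exists a b, [/\ a != b, v \in ends (t a) & v \in ends (t b)]) ->
  (loops t + #|vertices t| < #|I| + #|I|./2)%N.
Proof.
move=> Ieven tI t2.
have : (2 * #|vertices t| <= \sum_(a : I) #|ends (t a)|)%N.
  rewrite -sum_card_ends mulnC -sum_nat_const; apply: leq_sum => v /t2[a [b [ab va vb]]].
  by apply/card_gt1P; exists a, b; split=> //; rewrite finset.in_set.
have := sum_card_ends_loops t; have := odd_double_half #|I|.
rewrite (negbTE Ieven); lia.
Qed.

End VertexCounting.

(** * Moments of sums of centered i.i.d. variables *)

Section PowerSums.
Variable R : realFieldType.

(** The tangents at n and at n + 1 enclose the increment (n + 1)^(p + 1) - n^(p + 1) between (p + 1)
    n^p and (p + 1) (n + 1)^p; both bounds telescope. *)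
Lemma sum_expr_bounds p n :
  (p.+1%:R * (\sum_(j < n) j%:R ^+ p) <= n%:R ^+ p.+1 :> R) /\
  (n%:R ^+ p.+1 <= p.+1%:R * (\sum_(j < n) j%:R ^+ p + n%:R ^+ p) :> R).
Proof.
elim: n => [|n [IH1 IH2]].
  rewrite !big_ord0 mulr0 add0r expr0n lexx; split=> //.
  by rewrite mulr_ge0// exprn_ge0.
have d1 : n.+1%:R - n%:R = 1 :> R by rewrite -natrB// subSnn.
have d2 : n%:R - n.+1%:R = -1 :> R by rewrite -[LHS]opprB d1.
rewrite !big_ord_recr /=; split.
- have := @expr_tangent R n.+1%:R n%:R p (ler0n _ _) (ler0n _ _).
  rewrite d1 mulr1 => H.
  by apply: le_trans H; rewrite mulrDr lerD2r.
- have := @expr_tangent R n%:R n.+1%:R p (ler0n _ _) (ler0n _ _).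
  rewrite d2 mulrN1 => H.
  by rewrite [leRHS]mulrDr -lerBlDr; apply: le_trans H _; exact: IH2.
Qed.

Lemma sum_expr_approx p n :
  `|\sum_(j < n) j%:R ^+ p - n%:R ^+ p.+1 / p.+1%:R| <= n%:R ^+ p :> R.
Proof.
have [H1 H2] := sum_expr_bounds p n.
have p0 : 0 < p.+1%:R :> R by rewrite ltr0n.
set S := \sum_(j < n) _ in H1 H2 *.
have q1 : S <= n%:R ^+ p.+1 / p.+1%:R by rewrite ler_pdivlMr// mulrC.
have q2 : n%:R ^+ p.+1 / p.+1%:R <= S + n%:R ^+ p by rewrite ler_pdivrMr// mulrC.
have q0 := exprn_ge0 p (ler0n R n); clear H1 H2.
move: (n%:R ^+ p.+1 / p.+1%:R) (n%:R ^+ p) S q0 q1 q2 => x y S q0 q1 q2.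
by rewrite ler_norml; apply/andP; split; lra.
Qed.

End PowerSums.

Section MomentRecursion.
Variables (R : realFieldType) (m : nat -> nat -> R) (g : nat -> R).
Hypothesis m0 : forall s, m s 0 = (s == 0)%:R.
Hypothesis mS : forall s n, m s n.+1 =
  \sum_(r < s.+1) 'C(s, r)%:R * m (s - r)%N n * g r.
Hypothesis g0 : g 0 = 1.
Hypothesis g1 : g 1 = 0.

(** The moments of the centered normal law of variance [g 2], which satisfy mu_(s+2) = (s + 1)
    sigma^2 mu_s. In the application [m s n] is E L_n^s and [g r] is E g1(X_1)^r. *)
Fixpoint lead_moment (s : nat) : R :=
  match s with
  | 0 => 1
  | 1 => 0
  | s'.+2 => s'.+1%:R * g 2 * lead_moment s'
  end.

Lemma lead_moment_odd s : odd s -> lead_moment s = 0.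
Proof.
elim/ltn_ind: s => -[|[|s]] IH //= so; rewrite IH ?mulr0//.
by rewrite negbK in so.
Qed.

Lemma moment0 n : m 0 n = 1.
Proof.
elim: n => [|n IH]; first by rewrite m0.
by rewrite mS big_ord_recr big_ord0 /= IH g0 bin0 !mulr1 add0r.
Qed.

Lemma moment1 n : m 1 n = 0.
Proof.
elim: n => [|n IH]; first by rewrite m0.
by rewrite mS !big_ord_recr big_ord0 /= IH g1 !(mulr0, mul0r) !addr0.
Qed.

(** The term r = 1 drops out by [g1]; r = 2 drives the growth, and the terms from r = 3 on,
    reindexed in the last sum, are of lower order. *)
Lemma momentSS s n : m s.+2 n.+1 = m s.+2 n + 'C(s.+2, 2)%:R * g 2 * m s n +
  \sum_(r < s) 'C(s.+2, r.+3)%:R * m (s - r.+1)%N n * g r.+3.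
Proof.
rewrite mS !big_ord_recl /= bin0 g0 g1 mulr0 add0r !mulr1 subn0 mul1r.
rewrite -[in RHS]addrA; congr (_ + (_ + _)).
have -> : (s.+2 - bump 0 (bump 0 0) = s)%N by rewrite /bump /= subn2.
by rewrite mulrAC.
Qed.

Lemma moment_increments s n : m s.+2 n =
  \sum_(j < n) ('C(s.+2, 2)%:R * g 2 * m s j +
    \sum_(r < s) 'C(s.+2, r.+3)%:R * m (s - r.+1)%N j * g r.+3).
Proof.
elim: n => [|n IH]; first by rewrite big_ord0 m0.
by rewrite big_ord_recr /= -IH momentSS addrA.
Qed.

(* The error is bounded by a power of [n.+1] so that it also covers [n = 0],
   where the lower-order moments need not vanish. *)
Lemma moment_approx s : exists2 K : R, 0 <= K & forall n,
  `|m s n - lead_moment s * n%:R ^+ s./2| <= K * (s != 0)%:R * n.+1%:R ^+ (s.-1)./2.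
Proof.
elim/ltn_ind: s => -[|[|s]] IH.
- by exists 0 => // n; rewrite moment0 expr0 mulr1 subrr normr0 !mul0r.
- by exists 0 => // n; rewrite moment1 mul0r subrr normr0 !mul0r.
have bnd j : (j < s.+2)%N -> exists2 B : R, 0 <= B &
    forall n, `|m j n| <= B * n.+1%:R ^+ j./2.
  move=> /IH[K K0 HK]; exists (K + `|lead_moment j|) => [|n]; first exact: addr_ge0.
  rewrite -[m j n](subrK (lead_moment j * n%:R ^+ j./2)) mulrDl.
  apply: le_trans (ler_normD _ _) _; apply: lerD.
    apply: le_trans (HK n) _; rewrite -mulrA ler_wpM2l//.
    apply: (@le_trans _ _ (1 * n.+1%:R ^+ (j.-1)./2)).
      by rewrite ler_wpM2r ?exprn_ge0// lern1 leq_b1.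
    by rewrite mul1r ler_weXn2l ?ler1n// half_leq// leq_pred.
  rewrite normrM ler_wpM2l// ger0_norm ?exprn_ge0//.
  by rewrite lerXn2r ?nnegrE// ler_nat.
have [K K0 HK] := IH s (ltnW (ltnSn _)).
(* Here only moments of order at most s - 1 occur, which grow at most like the power [(s.-1)./2];
   the finitely many constants are summed into one. *)
have [B B0 HB] : exists2 B : R, 0 <= B & forall n (r : 'I_s),
    `|'C(s.+2, r.+3)%:R * m (s - r.+1)%N n * g r.+3| <= B * n.+1%:R ^+ (s.-1)./2.
  pose Bf (r : 'I_s) (B : R) := 0 <= B /\ forall n,
    `|'C(s.+2, r.+3)%:R * m (s - r.+1)%N n * g r.+3| <= B * n.+1%:R ^+ (s.-1)./2.
  have : forall r, exists B, Bf r B.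
    move=> r; have [|B B0 HB] := bnd (s - r.+1)%N; first by lia.
    exists ('C(s.+2, r.+3)%:R * B * `|g r.+3|); split=> [|n].
      by rewrite !mulr_ge0.
    rewrite !normrM normr_nat -!mulrA ler_wpM2l//.
    rewrite [leRHS](_ : _ = B * n.+1%:R ^+ s.-1./2 * `|g r.+3|); last by ring.
    rewrite ler_wpM2r//; apply: le_trans (HB n) _; rewrite ler_wpM2l//.
    by rewrite ler_weXn2l ?ler1n// half_leq//; lia.
  move=> /choice[b Hb]; exists (\sum_r b r).
    by apply: sumr_ge0 => r _; case: (Hb r).
  move=> n r; have [b0 Hr] := Hb r; apply: le_trans (Hr n) _.
  rewrite ler_wpM2r ?exprn_ge0// (bigD1 r)//= lerDl sumr_ge0// => r' _.
  by case: (Hb r').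
pose c := 'C(s.+2, 2)%:R * g 2.
(* Summing j^(s/2) over j < n divides by s/2 + 1, and for even s the quotient of ['C(s.+2, 2)] by
   s/2 + 1 is s + 1, the coefficient in [lead_moment]. For odd s both sides are 0. *)
have lead : c * lead_moment s / (s./2.+1)%:R = lead_moment s.+2.
  have [so|se] := boolP (odd s).
    by rewrite !lead_moment_odd ?mulr0 ?mul0r//= so.
  have sE : s.+2%:R = 2 * s./2.+1%:R :> R.
    rewrite -natrM; congr (_%:R); have := odd_double_half s.
    by rewrite (negbTE se); lia.
  have c2 : 2 * 'C(s.+2, 2)%:R = s.+2%:R * s.+1%:R :> R.
    by rewrite -!natrM; congr (_%:R); have := mul_bin_left s.+2 1; rewrite bin1; lia.
  have q0 : s./2.+1%:R != 0 :> R by rewrite pnatr_eq0.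
  have cE : 'C(s.+2, 2)%:R = s./2.+1%:R * s.+1%:R :> R.
    by have := c2; rewrite sE; lra.
  by rewrite /= /c cE; field.
pose D := `|c| * K + s%:R * B.
have D0 : 0 <= D by rewrite /D addr_ge0// mulr_ge0.
exists (`|c * lead_moment s| + D) => [|n]; first by rewrite addr_ge0.
rewrite mulr1.
have -> : m s.+2 n - lead_moment s.+2 * n%:R ^+ (s.+2)./2 =
  c * lead_moment s * (\sum_(j < n) j%:R ^+ s./2 - n%:R ^+ s./2.+1 / s./2.+1%:R) +
  \sum_(j < n) (c * (m s j - lead_moment s * j%:R ^+ s./2) +
    \sum_(r < s) 'C(s.+2, r.+3)%:R * m (s - r.+1)%N j * g r.+3).
  rewrite moment_increments -lead /= mulrBr.
  have -> : \sum_(j < n) (c * (m s j - lead_moment s * j%:R ^+ s./2) +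
      \sum_(r < s) 'C(s.+2, r.+3)%:R * m (s - r.+1)%N j * g r.+3) =
     \sum_(j < n) (c * m s j + \sum_(r < s) 'C(s.+2, r.+3)%:R * m (s - r.+1)%N j * g r.+3)
     - c * lead_moment s * \sum_(j < n) j%:R ^+ s./2.
    by rewrite mulr_sumr -sumrB; apply: eq_bigr => j _; ring.
  rewrite /c; ring.
rewrite mulrDl; apply: le_trans (ler_normD _ _) _; apply: lerD.
  rewrite normrM ler_wpM2l//; apply: le_trans (sum_expr_approx _ _ _) _.
  apply: (@le_trans _ _ (n.+1%:R ^+ s./2)); first by rewrite lerXn2r ?nnegrE// ler_nat.
  by rewrite ler_weXn2l ?ler1n// half_leq.
apply: le_trans (ler_norm_sum _ _ _) _.
(* For [s = 0] the sum of n bounded errors could cost a factor n that the claimed bound does not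
   have; but these errors are exactly 0, which is what the factor [(s != 0)] records. *)
have [s0|s0] := eqVneq s 0%N.
  rewrite big1 ?mulr_ge0 ?exprn_ge0// => j _.
  rewrite [X in _ + X]big1 ?addr0; last by case=> r r0; move: (r0); rewrite s0.
  have := HK j; have -> : (s != 0%N) = false by rewrite s0.
  rewrite normrM mulr0 mul0r normr_le0 => /eqP ->.
  by rewrite normr0 mulr0.
apply: (@le_trans _ _ (\sum_(j < n) D * n.+1%:R ^+ (s.-1)./2)).
  apply: ler_sum => j _.
  have jn : j.+1%:R ^+ (s.-1)./2 <= n.+1%:R ^+ (s.-1)./2 :> R.
    by rewrite lerXn2r ?nnegrE// ler_nat ltnW// ltnS.
  apply: (@le_trans _ _ (D * j.+1%:R ^+ (s.-1)./2)); last by rewrite ler_wpM2l.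
  rewrite /D mulrDl; apply: le_trans (ler_normD _ _) _; apply: lerD.
    rewrite normrM -mulrA ler_wpM2l//; apply: le_trans (HK j) _.
    by rewrite s0 mulr1.
  apply: le_trans (ler_norm_sum _ _ _) _.
  rewrite -mulrA mulr_natl -[in X in _ <= _ *+ X](card_ord s) -sumr_const.
  by apply: ler_sum => r _; exact: HB.
rewrite sumr_const card_ord -[leLHS]mulr_natl mulrCA ler_wpM2l//.
apply: (@le_trans _ _ (n.+1%:R * n.+1%:R ^+ (s.-1)./2)).
  by rewrite ler_wpM2r ?exprn_ge0// ler_nat.
by rewrite -exprS; move: s0; case: (s).
Qed.

End MomentRecursion.

(** * Moments of the centered sum *)

Section KernelSum.
Context d d' (T : measurableType d) (E : measurableType d') (R : realType)
  (P : probability T R).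
Variables (X : nat -> {RV P >-> E}) (h : E * E -> R).
Hypothesis X_iid : iid X.
Hypothesis h_meas : measurable_fun setT h.
Hypothesis h_sym : forall x y : E, h (x, y) = h (y, x).
Hypothesis h01_moments : all_moments P (fun w => h (X 0%N w, X 1%N w)).

Let mu := distribution P (X 0%N).

Definition pair_weight n (p : 'I_n * 'I_n) : R :=
  if p.1 == p.2 then n.-1%:R else 1.

Definition pair_term n (p : 'I_n * 'I_n) (w : T) : R :=
  pair_weight p * factor X h (val p.1, val p.2) (X^~ w).

Definition centered_sum n (w : T) : R :=
  \sum_(i < n) \sum_(j < n | (i < j)%N) (h (X i w, X j w) - kernel_mean mu h).

(** Each index is the smaller or the larger end of n - 1 pairs in all; this is the origin of the
    weight of a loop. *)
Lemma sum_ltn_addn n (a : 'I_n -> R) :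
  \sum_(i < n) \sum_(j < n | (i < j)%N) (a i + a j) = n.-1%:R * \sum_i a i.
Proof.
under eq_bigr do rewrite big_split /=.
rewrite big_split /= [X in _ + X](exchange_big_dep xpredT)//= -big_split /=.
rewrite mulr_sumr; apply: eq_bigr => i _.
rewrite !sumr_const -mulrnDr mulr_natl; congr (_ *+ _).
rewrite -cardUI [X in (_ + X)%N]eq_card0 ?addn0; last first.
  by move=> j; rewrite !inE; apply/negP => /andP[ij ji]; lia.
have -> : n.-1 = #|predC1 i|.
  by rewrite cardC1 card_ord.
by apply: eq_card => j; rewrite !inE -val_eqE /= neq_ltn orbC.
Qed.

Lemma centered_sumE n w : centered_sum n w = \sum_(p : 'I_n * 'I_n) pair_term p w.
Proof.
pose c (i j : 'I_n) := pair_term (i, j) w.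
rewrite (eq_bigr (fun p => c p.1 p.2)); last by case.
rewrite -(pair_bigA _ c) /=.
transitivity (n.-1%:R * linear_part X h n w +
    \sum_(i < n) \sum_(j < n | (i < j)%N) hoeffding2 mu h (X i w) (X j w)).
  rewrite /linear_part -sum_ltn_addn -big_split /=; apply: eq_bigr => i _.
  rewrite -big_split /=; apply: eq_bigr => j _.
  by rewrite /hoeffding1 /hoeffding2; ring.
rewrite /linear_part mulr_sumr -big_split /=; apply: eq_bigr => i _.
rewrite [in RHS](bigD1 i)//= /c /pair_term /pair_weight /factor /= !eqxx.
congr (_ + _); rewrite [LHS]big_mkcond [RHS]big_mkcond /=; apply: eq_bigr => j _.
rewrite [j == i]eq_sym; have [->|ij] := eqVneq i j; first by rewrite ltnn.
by have := ij; rewrite -val_eqE => /negbTE /= ->; rewrite mul1r.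
Qed.

Let C n k (t : {ffun 'I_k -> 'I_n * 'I_n}) : R :=
  mean P (fun w => \prod_a factor X h (val (t a).1, val (t a).2) (X^~ w)).

Lemma all_moments_factorsX n k (t : {ffun 'I_k -> 'I_n * 'I_n}) :
  all_moments P (fun w => \prod_a factor X h (val (t a).1, val (t a).2) (X^~ w)).
Proof. by apply: all_moments_prod => a _; exact: all_moments_factor. Qed.

Lemma prod_pair_weight n k (t : {ffun 'I_k -> 'I_n * 'I_n}) :
  \prod_a pair_weight (t a) = n.-1%:R ^+ loops t.
Proof.
rewrite /loops -prodr_const [RHS]big_mkcond /=; apply: eq_bigr => a _.
by rewrite finset.in_set /pair_weight.
Qed.

Lemma mean_centered_sumX n k : mean P (fun w => centered_sum n w ^+ k) =
  \sum_(t : {ffun 'I_k -> 'I_n * 'I_n}) n.-1%:R ^+ loops t * C t.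
Proof.
transitivity (mean P (fun w => \sum_(t : {ffun 'I_k -> 'I_n * 'I_n})
    n.-1%:R ^+ loops t * \prod_a factor X h (val (t a).1, val (t a).2) (X^~ w))).
  congr mean; apply/funext => w; rewrite centered_sumE.
  rewrite -[X in _ ^+ X](card_ord k) -prodr_const bigA_distr_bigA /=.
  by apply: eq_bigr => t _; rewrite /pair_term big_split /= prod_pair_weight.
rewrite mean_sum => [|t _]; last by apply: all_momentsZ; exact: all_moments_factorsX.
by apply: eq_bigr => t _; rewrite meanZ//; exact: all_moments_factorsX.
Qed.

(** Inserting the indicator of loops turns (n - 1) L_n into a sum over all pairs; after expansion
    only tuples made of loops survive. *)
Lemma mean_linear_partX n k :
  n.-1%:R ^+ k * mean P (fun w => linear_part X h n w ^+ k) =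
  \sum_(t : {ffun 'I_k -> 'I_n * 'I_n} | loops t == k) n.-1%:R ^+ loops t * C t.
Proof.
rewrite -meanZ; last exact: all_momentsX (all_moments_linear_part X_iid h_meas h01_moments n).
transitivity (mean P (fun w => \sum_(t : {ffun 'I_k -> 'I_n * 'I_n} | loops t == k)
    n.-1%:R ^+ loops t * \prod_a factor X h (val (t a).1, val (t a).2) (X^~ w))).
  congr mean; apply/funext => w; rewrite -exprMn.
  pose c (i j : 'I_n) := (i == j)%:R * pair_term (i, j) w.
  have -> : n.-1%:R * linear_part X h n w =
      \sum_(p : 'I_n * 'I_n) (p.1 == p.2)%:R * pair_term p w.
    rewrite [RHS](eq_bigr (fun p => c p.1 p.2)); last by case.
    rewrite -(pair_bigA _ c) /= /linear_part mulr_sumr; apply: eq_bigr => i _.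
    rewrite (bigD1 i)//= /c eqxx big1 ?addr0; last first.
      by move=> j /negbTE; rewrite eq_sym => ->; rewrite mul0r.
    by rewrite /pair_term /pair_weight /factor /= !eqxx mul1r.
  rewrite -[X in _ ^+ X](card_ord k) -prodr_const bigA_distr_bigA /=.
  rewrite [RHS]big_mkcond /=; apply: eq_bigr => t _.
  rewrite !big_split /= prod_pair_weight; case: eqP => [tk|tk].
    rewrite big1 ?mul1r// => a _.
    have : a \in [set a : 'I_k | (t a).1 == (t a).2]%SET.
      suff -> : [set a : 'I_k | (t a).1 == (t a).2]%SET = [set: 'I_k]%SET.
        by rewrite finset.in_setT.
      by apply/eqP; rewrite eqEcard finset.subsetT cardsT card_ord -{1}tk /loops leqnn.
    by rewrite finset.in_set => ->.
  have [a ta] : exists a, (t a).1 != (t a).2.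
    apply/existsP; rewrite -[X in is_true X]negbK negb_exists.
    apply/negP => /forallP tl; apply: tk; rewrite /loops.
    rewrite -[RHS](card_ord k) -cardsT; congr #|pred_of_set _|.
    by apply/finset.setP => a; rewrite finset.in_set finset.in_setT; have := tl a; rewrite negbK.
  by rewrite (bigD1 a)//= (negbTE ta) !mul0r.
rewrite mean_sum => [|t _]; last by apply: all_momentsZ; exact: all_moments_factorsX.
by apply: eq_bigr => t _; rewrite meanZ//; exact: all_moments_factorsX.
Qed.

(** If every vertex occurs in two positions, [loops_vertices_le] gives the power of n; otherwise
    some vertex occurs once and the mean is 0. The inverse power for the vertices is split off for
    [sum_vertices_le]. *)
Lemma normr_term_le n k (t : {ffun 'I_k.+1 -> 'I_n * 'I_n}) : (0 < n)%N ->
  ~~ odd k.+1 -> (loops t < k.+1)%N ->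
  `|n.-1%:R ^+ loops t * C t| <=
  factor_bound X h k.+1 * n%:R ^+ (k.+1 + k.+1./2).-1 * n%:R ^- #|vertices t|.
Proof.
move=> n0 ek tk.
have B0 : 0 <= factor_bound X h k.+1.
  apply: le_trans (normr_mean_prod_factor X_iid h_meas h01_moments
    (fun a => (val (t a).1, val (t a).2))).
  exact: normr_ge0.
have nR : 0 < n%:R :> R by rewrite ltr0n.
have [Vt|] := boolP [forall v in vertices t, [exists a, [exists b,
    [&& a != b, v \in ends (t a) & v \in ends (t b)]]]].
  have tV : (loops t + #|vertices t| < k.+1 + k.+1./2)%N.
    rewrite -[X in (X + X./2)%N](card_ord k.+1).
    apply: loops_vertices_le; rewrite ?card_ord// => v vV.
    have /existsP[a /existsP[b /and3P[? ? ?]]] := forall_inP Vt v vV.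
    by exists a, b.
  rewrite normrM mulrC -mulrA; apply: ler_pM => //.
    exact: (normr_mean_prod_factor X_iid h_meas h01_moments
      (fun a => (val (t a).1, val (t a).2))).
  rewrite ger0_norm ?exprn_ge0// ler_pdivlMr ?exprn_gt0//.
  apply: (@le_trans _ _ (n%:R ^+ loops t * n%:R ^+ #|vertices t|)).
    by rewrite ler_wpM2r ?exprn_ge0 ?lerXn2r ?nnegrE// ?ler_nat ?leq_pred// ltW.
  by rewrite -exprD ler_weXn2l ?ler1n//; lia.
rewrite negb_forall_in => /exists_inP[v vV].
rewrite negb_exists => /forallP nv.
have -> : C t = 0.
  have /finset.bigcupP[a0 _ va0] := vV.
  apply: (mean_prod_factor0 X_iid h_meas h_sym h01_moments (a0 := a0) (v := val v)).
    by move: va0; rewrite /ends !inE !(eq_sym v) /= !val_eqE.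
  move=> a aa0; have := nv a; rewrite negb_exists => /forallP/(_ a0).
  rewrite aa0 va0 andbT /= /ends !inE negb_or !(eq_sym v) /= !val_eqE.
  by [].
rewrite mulr0 normr0; apply: mulr_ge0; last by rewrite invr_ge0 exprn_ge0.
by apply: mulr_ge0 => //; exact: exprn_ge0.
Qed.

Lemma centered_sum_linear_part k : ~~ odd k.+1 -> exists2 K : R, 0 <= K &
  forall n, (0 < n)%N ->
  `|mean P (fun w => centered_sum n w ^+ k.+1) -
    n.-1%:R ^+ k.+1 * mean P (fun w => linear_part X h n w ^+ k.+1)| <=
  K * n%:R ^+ (k.+1 + k.+1./2).-1.
Proof.
move=> ek; pose B := factor_bound X h k.+1.
pose K0 : R := \sum_(v < (2 * #|'I_k.+1|).+1) ((v ^ 2) ^ #|'I_k.+1|)%:R.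
have B0 : 0 <= B.
  apply: le_trans (normr_mean_prod_factor X_iid h_meas h01_moments
    (fun a : 'I_k.+1 => (0, 0))).
  exact: normr_ge0.
exists (B * K0) => [|n n0]; first by rewrite mulr_ge0// sumr_ge0.
rewrite mean_centered_sumX mean_linear_partX.
rewrite (bigID (fun t : {ffun 'I_k.+1 -> 'I_n * 'I_n} => loops t == k.+1)) /=.
rewrite addrAC subrr add0r; apply: le_trans (ler_norm_sum _ _ _) _.
apply: (@le_trans _ _ (\sum_(t : {ffun 'I_k.+1 -> 'I_n * 'I_n} | loops t != k.+1)
    (B * n%:R ^+ (k.+1 + k.+1./2).-1 * n%:R ^- #|vertices t|))).
  apply: ler_sum => t tk; apply: normr_term_le => //.
  by rewrite ltn_neqAle tk -[leqRHS](card_ord k.+1) max_card.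
apply: (@le_trans _ _ (\sum_(t : {ffun 'I_k.+1 -> 'I_n * 'I_n})
    (B * n%:R ^+ (k.+1 + k.+1./2).-1 * n%:R ^- #|vertices t|))).
  rewrite [leRHS](bigID (fun t : {ffun 'I_k.+1 -> 'I_n * 'I_n} => loops t == k.+1)) /=.
  rewrite lerDr; apply: sumr_ge0 => t _.
  apply: mulr_ge0; last by rewrite invr_ge0 exprn_ge0.
  by apply: mulr_ge0 => //; exact: exprn_ge0.
rewrite -mulr_sumr mulrAC ler_wpM2r ?exprn_ge0// ler_wpM2l//.
exact: sum_vertices_le.
Qed.

Definition hoeffding1_moment r := mean mu (fun x => hoeffding1 mu h x ^+ r).

Lemma mean_centered_sumX_approx q : (0 < q)%N -> exists2 K : R, 0 <= K &
  forall n, (0 < n)%N ->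
  `|mean P (fun w => centered_sum n w ^+ (q.*2)) -
    lead_moment hoeffding1_moment q.*2 * n%:R ^+ (3 * q)| <= K * n%:R ^+ (3 * q).-1.
Proof.
move=> q0.
pose m s n := mean P (fun w => linear_part X h n w ^+ s).
have Mh := h_moments X_iid h_meas h01_moments.
have m0 s : m s 0 = (s == 0)%:R.
  rewrite /m (_ : (fun w => _) = (fun=> (s == 0)%:R)); first by rewrite mean_cst.
  by apply/funext => w; rewrite /linear_part big_ord0 expr0n.
have gg0 : hoeffding1_moment 0 = 1.
  by rewrite /hoeffding1_moment; under eq_fun do rewrite expr0; rewrite mean_cst.
have gg1 : hoeffding1_moment 1 = 0.
  by rewrite -[RHS](mean_hoeffding1 Mh); congr mean; apply/funext => x; rewrite expr1.
have mS s n : m s n.+1 = \sum_(r < s.+1) 'C(s, r)%:R * m (s - r)%N n * hoeffding1_moment r.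
  exact: (mean_linear_partX_recr X_iid h_meas h01_moments).
have [K1 K10 HK1] := moment_approx m0 mS gg0 gg1 q.*2.
have [k kE] : exists k, q.*2 = k.+1 by exists q.*2.-1; lia.
have [K2 K20 HK2] : exists2 K : R, 0 <= K & forall n, (0 < n)%N ->
  `|mean P (fun w => centered_sum n w ^+ q.*2) - n.-1%:R ^+ q.*2 * m q.*2 n| <=
  K * n%:R ^+ (3 * q).-1.
  have e : (3 * q = k.+1 + k.+1./2)%N by rewrite -kE; lia.
  rewrite kE e; apply: centered_sum_linear_part.
  by rewrite -kE odd_double.
set l := lead_moment _ _ in HK1 *.
(* Three errors: [K2] from the tuples containing some g2; [K1] from the moments of L_n, with 2^(q-1)
   because n + 1 <= 2n; and 2q from n^(2q) - (n - 1)^(2q) <= 2q n^(2q-1), again a tangent. *)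
exists (K2 + K1 * 2 ^+ q.-1 + `|l| * q.*2%:R) => [|n n0].
  by rewrite !addr_ge0 ?mulr_ge0 ?exprn_ge0.
have nR0 : 0 <= n%:R :> R by [].
have -> : mean P (fun w => centered_sum n w ^+ q.*2) - l * n%:R ^+ (3 * q) =
  (mean P (fun w => centered_sum n w ^+ q.*2) - n.-1%:R ^+ q.*2 * m q.*2 n) +
  n.-1%:R ^+ q.*2 * (m q.*2 n - l * n%:R ^+ q) +
  l * (n%:R ^+ q * (n.-1%:R ^+ q.*2 - n%:R ^+ q.*2)).
  by rewrite (_ : 3 * q = q + q.*2)%N ?exprD; [ring|lia].
rewrite !mulrDl; apply: le_trans (ler_normD _ _) _; apply: lerD.
  apply: le_trans (ler_normD _ _) _; apply: lerD; first exact: HK2.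
  rewrite normrM ger0_norm ?exprn_ge0//.
  have e1 : (q.*2.-1)./2 = q.-1 by lia.
  have := HK1 n; rewrite e1 doubleK (_ : (q.*2 != 0)%N = true) ?mulr1; last by lia.
  move=> H; apply: (@le_trans _ _ (n%:R ^+ q.*2 * (K1 * (2 ^+ q.-1 * n%:R ^+ q.-1)))).
    apply: ler_pM; rewrite ?exprn_ge0//.
      by rewrite lerXn2r ?nnegrE// ler_nat leq_pred.
    apply: le_trans H _; rewrite ler_wpM2l// -exprMn lerXn2r ?nnegrE//.
    by rewrite -natrM ler_nat; lia.
  rewrite mulrCA -mulrA ler_wpM2l// mulrCA ler_wpM2l ?exprn_ge0// -exprD.
  by rewrite ler_weXn2l ?ler1n//; lia.
rewrite normrM -mulrA ler_wpM2l// normrM ger0_norm ?exprn_ge0//.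
have tan := @expr_tangent R n.-1%:R n%:R q.*2.-1 (ler0n _ _) (ler0n _ _).
have e2 : q.*2.-1.+1 = q.*2 by lia.
rewrite e2 in tan.
have e3 : n.-1%:R - n%:R = -1 :> R.
  by rewrite -[in n%:R](prednK n0) -[n.-1.+1]addn1 natrD opprD addrA subrr add0r.
rewrite e3 mulrN1 in tan.
rewrite distrC ger0_norm; last first.
  by rewrite subr_ge0 lerXn2r ?nnegrE// ler_nat leq_pred.
apply: (@le_trans _ _ (n%:R ^+ q * (q.*2%:R * n%:R ^+ q.*2.-1))).
  by rewrite ler_wpM2l ?exprn_ge0// lerBlDr addrC -lerBlDr.
rewrite mulrCA ler_wpM2l// -exprD.
by rewrite ler_weXn2l ?ler1n//; lia.
Qed.

End KernelSum.

(** * Normal moments *)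

(* [odd_dfact q] is (2q - 1)!!, with (-1)!! = 1. *)
Fixpoint odd_dfact (q : nat) : nat :=
  if q is q'.+1 then (q'.*2.+1 * odd_dfact q')%N else 1%N.

Section NormalMoments.
Context (R : realType).
Notation leb := (@lebesgue_measure R).
Notation psi := (@normal_pdf R 0 1).

Let psiE : psi = fun x => normal_peak 1 * expR (- (x ^+ 2 / 2)).
Proof.
rewrite normal_pdfE ?oner_eq0//; apply/funext => x.
by rewrite /normal_fun subr0 expr1n mulNr.
Qed.

Let psi_ge0 x : 0 <= psi x. Proof. exact: normal_pdf_ge0. Qed.

Let continuous_psi : continuous psi.
Proof. by apply: continuous_normal_pdf; exact: oner_neq0. Qed.

Let even_moment_fun q x := x ^+ q.*2 * psi x.

Let even_moment_fun_ge0 q x : 0 <= even_moment_fun q x.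
Proof. by rewrite mulr_ge0// -mul2n exprM exprn_ge0// sqr_ge0. Qed.

Let continuous_even_moment_fun q : continuous (even_moment_fun q).
Proof.
by move=> x; apply: cvgM; [exact: exprn_continuous|exact: continuous_psi].
Qed.

Let measurable_even_moment_fun q D :
  measurable_fun D (EFin \o even_moment_fun q).
Proof.
apply/measurable_EFinP/measurable_funTS; exact: continuous_measurable_fun.
Qed.

(** An antiderivative linking consecutive even moments: psi' = - x psi makes its derivative (2q + 1)
    x^(2q) psi - x^(2q+2) psi, so the fundamental theorem of calculus does the work of an
    integration by parts. *)
Let odd_fun q x := x ^+ q.*2.+1 * psi x.

Let is_derive_odd_fun q (x : R) : is_derive x 1 (odd_fun q)
  (q.*2.+1%:R * even_moment_fun q x - even_moment_fun q.+1 x).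
Proof.
rewrite (_ : odd_fun q = (@idfun R) ^+ q.*2.+1 *
    (cst (normal_peak 1) * (expR \o (cst (- 2^-1) * (@idfun R) ^+ 2)))); last first.
  apply/funext => y; rewrite /odd_fun psiE !fctE /=; congr (_ * (_ * expR _)).
  by rewrite mulNr mulrC.
apply: is_derive_eq.
rewrite /even_moment_fun psiE !fctE /GRing.scale /= doubleS !exprS expr0.
rewrite [x * (x * 1) / 2]mulrC !mulr1 mulNr.
by move: (expR _) => e; field.
Qed.

Let integral_even_moment_rec q n :
  (\int[leb]_(x in `[0%R, n.+1%:R]) (even_moment_fun q.+1 x)%:E =
   q.*2.+1%:R%:E * \int[leb]_(x in `[0%R, n.+1%:R]) (even_moment_fun q x)%:E -
   (odd_fun q n.+1%:R)%:E)%E.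
Proof.
pose I : set R := `[0%R, n.+1%:R]%classic.
have iE p : leb.-integrable I (EFin \o even_moment_fun p).
  apply: continuous_compact_integrable; first exact: segment_compact.
  apply: continuous_subspaceT; exact: continuous_even_moment_fun.
have dF x : derivable (odd_fun q) x 1 by case: (is_derive_odd_fun q x).
have cF : continuous (odd_fun q).
  by move=> x; apply: differentiable_continuous; exact/derivable1_diffP.
have := @continuous_FTC2 R
  (fun x => q.*2.+1%:R * even_moment_fun q x - even_moment_fun q.+1 x)
  (odd_fun q) 0 n.+1%:R.
have -> : odd_fun q 0 = 0 by rewrite /odd_fun exprS !mul0r.
rewrite sube0 => H.
have {}H : (\int[leb]_(x in I) (q.*2.+1%:R * even_moment_fun q x - even_moment_fun q.+1 x)%:E =
    (odd_fun q n.+1%:R)%:E)%E.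
  apply: H.
  - by rewrite ltr0n.
  - apply: continuous_subspaceT => x; apply: cvgB; last exact: continuous_even_moment_fun.
    by apply: cvgM; [exact: cvg_cst|exact: continuous_even_moment_fun].
  - split=> [x _||]; first exact: dF.
      by apply: cvg_at_right_filter; exact: cF.
    by apply: cvg_at_left_filter; exact: cF.
  - move=> x _; rewrite derive1E.
    by have [_ ->] := is_derive_odd_fun q x.
have i1 : leb.-integrable I (EFin \o (fun x => q.*2.+1%:R * even_moment_fun q x)).
  apply: continuous_compact_integrable; first exact: segment_compact.
  apply: continuous_subspaceT => x.
  by apply: cvgM; [exact: cvg_cst|exact: continuous_even_moment_fun].
rewrite -H integralB_EFin; [|exact: measurable_itv|exact: i1|exact: iE].
have -> : (\int[leb]_(x in I) (q.*2.+1%:R * even_moment_fun q x)%:E =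
  q.*2.+1%:R%:E * \int[leb]_(x in I) (even_moment_fun q x)%:E)%E.
  by rewrite -integralZl; [|exact: measurable_itv|exact: iE].
have fE p : (\int[leb]_(x in I) (even_moment_fun p x)%:E =
    (fine (\int[leb]_(x in I) (even_moment_fun p x)%:E))%:E)%E.
  by rewrite fineK//; apply: integrable_fin_num; [exact: measurable_itv|exact: iE].
rewrite (fE q) (fE q.+1) -EFinM -!EFinB; congr EFin; ring.
Qed.

(** With y = x^2/2 and x = n + 1, exp(y) >= y^(q+1)/(q+1)! gives a decay x^(-2q-2) against the
    factor x^(2q+1), which leaves 1/x. *)
Let odd_fun_le q n : odd_fun q n.+1%:R <=
  normal_peak 1 * q.+1`!%:R * 2 ^+ q.+1 * harmonic n.
Proof.
set x : R := n.+1%:R; have x0 : 0 < x by rewrite ltr0n.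
have y0 : 0 <= x ^+ 2 / 2 by rewrite divr_ge0// sqr_ge0.
have c0 : 0 <= normal_peak 1 :> R by exact: normal_peak_ge0.
have yq0 : 0 < (x ^+ 2 / 2) ^+ q.+1 / q.+1`!%:R.
  by rewrite divr_gt0 ?ltr0n ?fact_gt0// exprn_gt0// divr_gt0// exprn_gt0.
have eb : expR (- (x ^+ 2 / 2)) <= q.+1`!%:R * 2 ^+ q.+1 / x ^+ q.*2.+2.
  rewrite expRN; apply: (@le_trans _ _ ((x ^+ 2 / 2) ^+ q.+1 / q.+1`!%:R)^-1).
    rewrite lef_pV2 ?posrE ?expR_gt0//.
    by apply: le_trans (expR_ge1Dxn q y0); rewrite lerDr.
  by rewrite invf_div expr_div_n -exprM mul2n doubleS invf_div mulrA.
rewrite /odd_fun psiE /harmonic /= -/x.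
apply: (@le_trans _ _ (x ^+ q.*2.+1 *
    (normal_peak 1 * (q.+1`!%:R * 2 ^+ q.+1 / x ^+ q.*2.+2)))).
  apply: ler_wpM2l; first by rewrite exprn_ge0// ltW.
  exact: ler_wpM2l.
have xn : x != 0 by rewrite gt_eqF.
rewrite [x ^+ q.*2.+2]exprS invfM.
have xq : x ^+ q.*2.+1 / x ^+ q.*2.+1 = 1 by rewrite divff// expf_neq0.
have gen (u a c e f : R) : u * f = 1 -> u * (a * (c * (e * f))) = a * c * e.
  by move=> uf; rewrite -[RHS]mulr1 -uf; ring.
by rewrite gen// !mulrA.
Qed.

Let cvg_odd_fun q : odd_fun q n.+1%:R @[n --> \oo] --> 0.
Proof.
apply: (@squeeze_cvgr _ _ _ _ (fun=> 0)
    (fun n => normal_peak 1 * q.+1`!%:R * 2 ^+ q.+1 * harmonic n)).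
- apply: nearW => n; rewrite odd_fun_le andbT.
  by rewrite /odd_fun mulr_ge0// exprn_ge0.
- exact: cvg_cst.
- rewrite -[X in _ --> X](mulr0 (normal_peak 1 * q.+1`!%:R * 2 ^+ q.+1)).
  by apply: cvgMr; exact: cvg_harmonic.
Qed.

Let itv0y_bigcup : `[0%R, +oo[%classic = \bigcup_n `[0%R, n.+1%:R]%classic :> set R.
Proof.
apply/seteqP; split=> [x|x [n _]] /=; last by rewrite !in_itv /= => /andP[->].
rewrite in_itv /= andbT => x0; exists (Num.trunc x) => //=.
by rewrite in_itv /= x0 ltW// truncnS_gt.
Qed.

Let cvg_even_moment q :
  (\int[leb]_(x in `[0%R, n.+1%:R]) (even_moment_fun q x)%:E @[n --> \oo] -->
   \int[leb]_(x in `[0%R, +oo[) (even_moment_fun q x)%:E)%E.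
Proof.
rewrite itv0y_bigcup; apply: ge0_nondecreasing_set_cvg_integral => //.
- apply/nondecreasing_seqP => n; apply/subsetPset => x /=.
  rewrite !in_itv /= => /andP[-> /le_trans]; apply.
  by rewrite ler_nat.
- by move=> n; exact: measurable_even_moment_fun.
- by move=> n x _; rewrite lee_fin.
Qed.

(** On the half line the boundary term vanishes at 0 and in the limit, so each step multiplies by 2q
    + 1. The start q = 0 is half of the total mass 1, by symmetry. *)
Lemma half_normal_even_moment q :
  (\int[leb]_(x in `[0%R, +oo[) (even_moment_fun q x)%:E = ((odd_dfact q)%:R / 2)%:E)%E.
Proof.
elim: q => [|q IH].
  have e0 : even_moment_fun 0 = psi.
    by apply/funext => x; rewrite /even_moment_fun expr0 mul1r.
  have : (\int[leb]_x (even_moment_fun 0 x)%:E = 1)%E.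
    by rewrite e0; exact: integral_normal_pdf.
  rewrite ge0_symfun_integralT//; last by move=> x; rewrite e0 psiE /= sqrrN.
  rewrite -set_itvcy.
  case: (\int[leb]_(x in _) _)%E => [r| |] /=.
  - by move=> [/=] r2; congr EFin; rewrite /odd_dfact; lra.
  - by rewrite mulry gtr0_sg// mul1e.
  - by rewrite mulrNy gtr0_sg// mul1e.
have <- := cvg_lim (@ereal_hausdorff R) (@cvg_even_moment q.+1).
apply/cvg_lim; first exact: ereal_hausdorff.
have H : ((q.*2.+1%:R%:E * \int[leb]_(x in `[0%R, n.+1%:R]) (even_moment_fun q x)%:E -
   (odd_fun q n.+1%:R)%:E) @[n --> \oo] --> q.*2.+1%:R%:E * ((odd_dfact q)%:R / 2)%:E - 0%:E)%E.
  apply: cvgeB => //.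
    by apply: cvgeZl => //; rewrite -IH; exact: cvg_even_moment.
  by apply: cvg_EFin; [exact: nearW|exact: cvg_odd_fun].
under eq_fun do rewrite integral_even_moment_rec.
by move: H; rewrite sube0 -EFinM mulrA -natrM.
Qed.

Lemma integral_even_moment q :
  (\int[leb]_x (x ^+ q.*2 * psi x)%:E = ((odd_dfact q)%:R)%:E)%E.
Proof.
have := @ge0_symfun_integralT R (even_moment_fun q) (even_moment_fun_ge0 q)
  (@continuous_even_moment_fun q).
move=> ->; last first.
  by move=> x; rewrite /even_moment_fun psiE /= sqrrN -mul2n !exprM sqrrN.
by rewrite -set_itvcy half_normal_even_moment -EFinM; congr EFin; field.
Qed.

End NormalMoments.

Lemma lead_momentE (R : realFieldType) (g : nat -> R) q :
  lead_moment g q.*2 = (odd_dfact q)%:R * g 2 ^+ q.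
Proof.
elim: q => [|q IH]; first by rewrite expr0 mulr1.
by rewrite doubleS /= IH exprS natrM; ring.
Qed.

Section StandardNormal.
Context d (T : measurableType d) (R : realType) (Q : probability T R).

Lemma standard_normal_even_moment (N : {RV Q >-> R}) q : standard_normal N ->
  ('E_Q[(fun w => N w ^+ q.*2)%R] = ((odd_dfact q)%:R)%:E)%E.
Proof.
move=> N_normal; rewrite unlock.
pose f (x : R) : \bar R := (x ^+ q.*2)%:E.
have f0 x : (0 <= f x)%E by rewrite lee_fin -mul2n exprM exprn_ge0// sqr_ge0.
have mf : measurable_fun setT f by apply/measurable_EFinP; exact: measurable_funX.
transitivity (\int[distribution Q N]_x f x)%E.
  by rewrite ge0_integral_distribution.
(* The identity map carries [normal_prob 0 1], a measure for the sigma-algebra generated by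
   half-open intervals, to the measurable structure used for the law of [N]. *)
have mid : measurable_fun [set: g_sigma_algebraType (R.-ocitv.-measurable)] (id : _ -> R).
  by move=> _ A mA; rewrite setTI.
transitivity (\int[distribution (normal_prob 0 1) (mfun_of mid)]_x f x)%E.
  by apply: eq_measure_integral => A mA _; exact: N_normal.
rewrite ge0_integral_distribution//=.
(* The Radon-Nikodym derivative and the normal density have the same integral over every measurable
   set, hence agree almost everywhere. *)
have dom := @normal_prob_dominates R 0 1.
rewrite -(Radon_Nikodym_SigmaFinite.change_of_variables dom f0)//.
rewrite -integral_even_moment; apply: ae_eq_integral => //.
- apply: emeasurable_funM => //.
  exact: measurable_int (Radon_Nikodym_SigmaFinite.f_integrable dom).
- apply/measurable_EFinP; apply: measurable_funM; last exact: measurable_normal_pdf.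
  exact: measurable_funX.
under [X in ae_eq _ _ _ X]eq_fun do rewrite EFinM.
apply: ae_eqe_mul2l; apply: integral_ae_eq => //.
- exact: Radon_Nikodym_SigmaFinite.f_integrable.
- by apply/measurable_EFinP; exact: measurable_normal_pdf.
- by move=> A _ mA; rewrite -Radon_Nikodym_SigmaFinite.f_integral.
Qed.

End StandardNormal.

(** * Ratios of two asymptotic expansions *)

Section RatioAsymptotics.
Variable R : realFieldType.

(** The constant is 1 + 2 + ... + 2^(q-1), the value at y = 2 of the cofactor of y - 1 in y^q -
    1. *)
Lemma normr_expr_sub1 (y : R) q : 0 <= y <= 2 ->
  `|y ^+ q - 1| <= (2 ^+ q - 1) * `|y - 1|.
Proof.
move=> /andP[y0 y2]; elim: q => [|q IH]; first by rewrite !expr0 !subrr normr0 mul0r.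
have -> : y ^+ q.+1 - 1 = y * (y ^+ q - 1) + (y - 1) by rewrite exprS; ring.
have -> : (2 ^+ q.+1 - 1) * `|y - 1| =
    2 * ((2 ^+ q - 1) * `|y - 1|) + `|y - 1| by rewrite exprS; ring.
apply: le_trans (ler_normD _ _) _; rewrite lerD2r normrM (ger0_norm y0).
by apply: ler_pM.
Qed.

(** Divided by their leading powers, [a] and [b] become x = D + O(1/n) and y = 1 + O(1/n), and the
    ratio becomes x / y^q. *)
Lemma ratio_asymptotics (a b : nat -> R) (D s K1 K2 : R) q : (0 < q)%N ->
  0 < s -> 0 <= D -> 0 <= K1 -> 0 <= K2 ->
  (forall n, (0 < n)%N ->
    `|a n - D * s ^+ q * n%:R ^+ (3 * q)| <= K1 * n%:R ^+ (3 * q).-1) ->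
  (forall n, (0 < n)%N -> `|b n - s * n%:R ^+ 3| <= K2 * n%:R ^+ 2) ->
  exists C r : R, forall n, (0 < n)%N -> r <= n%:R ->
    `|a n / b n ^+ q - D| <= C * n%:R^-1.
Proof.
move=> q0 s0 D0 K10 K20 Ha Hb.
pose L1 := K1 / s ^+ q; pose L2 := K2 / s.
(* The threshold [2 * L2] forces |y - 1| <= 1/2, hence y >= 1/2. The outer 2^q bounds y^(-q); the
   inner one is 2^q - 1 from [normr_expr_sub1], rounded up. *)
exists (2 ^+ q * (L1 + D * (2 ^+ q * L2))), (2 * L2) => n n0 rn.
have nR : 0 < n%:R :> R by rewrite ltr0n.
have nn : n%:R != 0 :> R by rewrite gt_eqF.
have sn : s != 0 by rewrite gt_eqF.
pose x := a n / (s ^+ q * n%:R ^+ (3 * q)).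
pose y := b n / (s * n%:R ^+ 3).
have xD : `|x - D| <= L1 / n%:R.
  have p0 : 0 < s ^+ q * n%:R ^+ (3 * q) by rewrite mulr_gt0// exprn_gt0.
  have -> : x - D = (a n - D * s ^+ q * n%:R ^+ (3 * q)) / (s ^+ q * n%:R ^+ (3 * q)).
    by rewrite mulrBl -mulrA mulfK// gt_eqF.
  rewrite normrM normfV (gtr0_norm p0) ler_pdivrMr//.
  apply: le_trans (Ha n n0) _.
  have -> : L1 / n%:R * (s ^+ q * n%:R ^+ (3 * q)) =
      (K1 * (n%:R ^+ (3 * q) / n%:R)) * (s ^+ q / s ^+ q) by rewrite /L1; ring.
  rewrite divff ?expf_neq0// mulr1.
  have {2}-> : (3 * q = (3 * q).-1.+1)%N by lia.
  by rewrite exprSr mulfK.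
have y1 : `|y - 1| <= L2 / n%:R.
  have p0 : 0 < s * n%:R ^+ 3 by rewrite mulr_gt0// exprn_gt0.
  have -> : y - 1 = (b n - s * n%:R ^+ 3) / (s * n%:R ^+ 3).
    by rewrite mulrBl divff// gt_eqF.
  rewrite normrM normfV (gtr0_norm p0) ler_pdivrMr//.
  apply: le_trans (Hb n n0) _; rewrite le_eqVlt /L2; apply/orP; left; apply/eqP.
  by field; rewrite nn sn.
have L2n : L2 / n%:R <= 2^-1.
  by rewrite ler_pdivrMr// mulrC ler_pdivlMr// mulrC.
have /andP[ylo yhi] : 2^-1 <= y <= 2.
  have := le_trans y1 L2n; rewrite ler_norml => /andP[? ?].
  by apply/andP; split; lra.
have y0 : 0 < y by lra.
have -> : a n / b n ^+ q - D = (x - D * y ^+ q) / y ^+ q.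
  have yb : y ^+ q = b n ^+ q / (s ^+ q * n%:R ^+ (3 * q)).
    by rewrite /y expr_div_n exprMn -exprM.
  rewrite mulrBl mulfK; last by rewrite expf_neq0// gt_eqF.
  congr (_ - _); rewrite yb /x invf_div.
  have p0 : s ^+ q * n%:R ^+ (3 * q) != 0 by rewrite mulf_neq0// expf_neq0.
  by rewrite mulrA divfK.
have yq : 2^-1 ^+ q <= y ^+ q by rewrite lerXn2r// nnegrE ltW.
have yq0 : 0 < y ^+ q by rewrite exprn_gt0.
rewrite normrM normfV (gtr0_norm yq0) ler_pdivrMr//.
have num : `|x - D * y ^+ q| <= (L1 + D * (2 ^+ q * L2)) / n%:R.
  have -> : x - D * y ^+ q = (x - D) - D * (y ^+ q - 1) by ring.
  apply: le_trans (ler_normB _ _) _; rewrite mulrDl; apply: lerD => //.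
  rewrite normrM (ger0_norm D0) -!mulrA ler_wpM2l//.
  apply: le_trans (normr_expr_sub1 _ _) _; first by rewrite ltW.
  apply: ler_pM => //; first by rewrite subr_ge0 exprn_ege1// ler1n.
    by rewrite gerBl.
  by rewrite mulrA.
apply: le_trans num _.
have M0 : 0 <= (L1 + D * (2 ^+ q * L2)) / n%:R.
  by rewrite !(divr_ge0, addr_ge0, mulr_ge0, exprn_ge0)// ltW// exprn_gt0.
rewrite [leRHS](_ : _ = (L1 + D * (2 ^+ q * L2)) / n%:R * (2 ^+ q * y ^+ q)); last by ring.
have y2 : 1 <= 2 * y by lra.
by rewrite ler_peMr// -exprMn exprn_ege1.
Qed.

End RatioAsymptotics.

(** * U-statistics *)

Section UStatMoments.
Context d d' (T : measurableType d) (E : measurableType d') (R : realType)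
  (P : probability T R).
Variables (X : nat -> {RV P >-> E}) (h : E * E -> R).
Hypothesis X_iid : iid X.
Hypothesis h_meas : measurable_fun setT h.
Hypothesis h_sym : forall x y : E, h (x, y) = h (y, x).
Hypothesis h01_moments : all_moments P (fun w => h (X 0%N w, X 1%N w)).

Let mu := distribution P (X 0%N).
Let Mh := h_moments X_iid h_meas h01_moments.

Lemma expectationE (f : T -> R) : all_moments P f -> ('E_P[f] = (mean P f)%:E)%E.
Proof. by move=> Mf; rewrite unlock mean_integral. Qed.

(* The integrals under [fine] may be infinite or undefined, hence the passage to
   positive and negative parts. *)
Lemma h1E : h1 X h = kernel_proj mu h.
Proof.
apply/funext => x; rewrite /h1 /kernel_proj /mean unlock; congr fine.
have mhx := measurable_section Mh x.
have muE f : measurable_fun [set: E] f -> (forall y, (0 <= f y)%E) ->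
    (\int[P]_w f (X 1%N w) = \int[mu]_y f y)%E.
  move=> mf f0; transitivity (\int[distribution P (X 1%N)]_y f y)%E.
    by rewrite ge0_integral_distribution.
  by apply: eq_measure_integral => A mA _; exact: distribution_iid.
pose g y := (h (x, y))%:E.
have mg : measurable_fun [set: E] g by exact/measurable_EFinP.
rewrite -[fun w => (h (x, X 1%N w))%:E]/(g \o X 1%N) -/g.
rewrite integralE [RHS]integralE funepos_comp funeneg_comp; congr (_ - _)%E.
- by apply: muE; [exact: measurable_funepos|move=> y; exact: funepos_ge0].
- by apply: muE; [exact: measurable_funeneg|move=> y; exact: funeneg_ge0].
Qed.

Lemma sigma1_sqE : (sigma1_sq X h = (hoeffding1_moment X h 2)%:E)%E.
Proof.
have Mp := all_moments_X X_iid 0 (all_moments_kernel_proj Mh).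
rewrite /sigma1_sq h1E /variance unlock (expectationE Mp) /=.
have -> : mean P (kernel_proj mu h \o X 0%N) = kernel_mean mu h.
  exact: (mean_X X_iid 0 (all_moments_kernel_proj Mh)).
have M2 := all_momentsX 2 (all_moments_hoeffding1 Mh).
rewrite /hoeffding1_moment -(mean_X X_iid 0 M2) -expectationE; last exact: (all_moments_X X_iid _ M2).
by congr expectation; apply/funext => w; rewrite expr2.
Qed.

Lemma all_moments_centered_sum n : all_moments P (centered_sum X h n).
Proof.
apply: all_moments_sum => i _; apply: all_moments_sum => j ij.
apply: all_momentsB; last exact: all_moments_cst.
by apply: (all_moments_pair X_iid _ Mh); rewrite ltn_eqF.
Qed.

Lemma mean_centered_sum n : mean P (centered_sum X h n) = 0.
Proof.
have Mij (i j : 'I_n) : (i < j)%N -> all_moments P (fun w => h (X i w, X j w)).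
  by move=> ij; apply: (all_moments_pair X_iid _ Mh); rewrite ltn_eqF.
rewrite mean_sum => [|i _]; last first.
  apply: all_moments_sum => j ij.
  by apply: all_momentsB (Mij _ _ ij) _; exact: all_moments_cst.
apply: big1 => i _; rewrite mean_sum => [|j ij]; last first.
  by apply: all_momentsB (Mij _ _ ij) _; exact: all_moments_cst.
apply: big1 => j ij; rewrite meanB; [|exact: Mij|exact: all_moments_cst].
by rewrite (mean_pair X_iid _ Mh) ?ltn_eqF// (mean_kernel Mh) mean_cst subrr.
Qed.

Lemma Ustat_centered n w : (1 < n)%N ->
  Ustat X h n w = ('C(n, 2)%:R)^-1 * centered_sum X h n w + kernel_mean mu h.
Proof.
move=> n1; rewrite /Ustat.
have c0 : 'C(n, 2)%:R != 0 :> R by rewrite pnatr_eq0 -lt0n bin_gt0.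
have -> : \sum_(i < n) \sum_(j < n | (i < j)%N) h (X i w, X j w) =
    centered_sum X h n w + 'C(n, 2)%:R * kernel_mean mu h.
  (* Splitting theta into two halves lets [sum_ltn_addn] count the pairs. *)
  have -> : 'C(n, 2)%:R * kernel_mean mu h =
      \sum_(i < n) \sum_(j < n | (i < j)%N) (kernel_mean mu h / 2 + kernel_mean mu h / 2).
    rewrite (sum_ltn_addn (fun=> kernel_mean mu h / 2)) sumr_const card_ord.
    have bE : 2 * 'C(n, 2)%:R = n.-1%:R * n%:R :> R.
      rewrite -!natrM; congr (_%:R); have := mul_bin_left n 1.
      by rewrite bin1 subn1 => ->; rewrite mulnC.
    rewrite -mulr_natl; have -> : 'C(n, 2)%:R = n.-1%:R * n%:R / 2 :> R.
      by rewrite -bE; field.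
    by field.
  rewrite /centered_sum -big_split /=; apply: eq_bigr => i _.
  rewrite -big_split /=; apply: eq_bigr => j _.
  by rewrite -/mu; field.
by rewrite mulrDr mulKf.
Qed.

(** Standardization is invariant under affine maps of positive slope; the slope, the inverse of
    ['C(n, 2)], is positive once n > 1. *)
Lemma ZstatE n w : (1 < n)%N -> Zstat X h n w =
  centered_sum X h n w / Num.sqrt (mean P (fun w => centered_sum X h n w ^+ 2)).
Proof.
move=> n1; pose c : R := 'C(n, 2)%:R^-1.
have c0 : 0 < c by rewrite invr_gt0 ltr0n bin_gt0.
have UE : Ustat X h n = fun w => c * centered_sum X h n w + kernel_mean mu h.
  by apply/funext => v; rewrite Ustat_centered.
have Mc := all_moments_centered_sum n.
have MU : all_moments P (Ustat X h n).
  by rewrite UE; apply: all_momentsD (all_moments_cst _ _); exact: all_momentsZ.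
have EU : mean P (Ustat X h n) = kernel_mean mu h.
  rewrite UE meanD; [|exact: all_momentsZ|exact: all_moments_cst].
  by rewrite meanZ// mean_centered_sum mulr0 add0r mean_cst.
have VU : fine 'V_P[Ustat X h n]%E = c ^+ 2 * mean P (fun w => centered_sum X h n w ^+ 2).
  rewrite /variance unlock (expectationE MU) EU /=.
  have M2 := all_momentsX 2 Mc.
  rewrite -meanZ//; transitivity (fine 'E_P[(fun w => c ^+ 2 * centered_sum X h n w ^+ 2)%R]%E).
    congr (fine (expectation _ _)); apply/funext => v.
    by rewrite UE !fctE /=; ring.
  by rewrite expectationE//; exact: all_momentsZ.
rewrite /Zstat (expectationE MU) EU VU /= UE addrK.
rewrite sqrtrM ?sqr_ge0// sqrtr_sqr gtr0_norm// invfM.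
by rewrite mulrACA divff ?mul1r// gt_eqF.
Qed.

(** The even power removes the square root, which leaves a ratio of two moments of S_n. *)
Lemma mean_Zstat_even n q : (1 < n)%N ->
  ('E_P[(fun w => Zstat X h n w ^+ q.*2)%R] =
   (mean P (fun w => centered_sum X h n w ^+ q.*2) /
    mean P (fun w => centered_sum X h n w ^+ 2) ^+ q)%:E)%E.
Proof.
move=> n1; set e2 := mean P (fun w => _ ^+ 2).
have e20 : 0 <= e2 by apply: mean_ge0 => w; exact: sqr_ge0.
have Mq := all_momentsX q.*2 (all_moments_centered_sum n).
have ZE : (fun w => Zstat X h n w ^+ q.*2) =
    (fun w => (e2 ^+ q)^-1 * centered_sum X h n w ^+ q.*2).
  apply/funext => w; rewrite ZstatE// expr_div_n -/e2 -[X in _ / _ ^+ X]mul2n.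
  by rewrite [X in _ / X]exprM sqr_sqrtr// mulrC.
by rewrite ZE expectationE ?meanZ//; [rewrite mulrC|exact: all_momentsZ].
Qed.

End UStatMoments.

Theorem mainTheorem11
  (R : realType)
  (d d' d0 : measure_display)
  (T : measurableType d) (P : probability T R)
  (E : measurableType d') (X : nat -> {RV P >-> E})
  (T0 : measurableType d0) (Q : probability T0 R) (N : {RV Q >-> R})
  (h : E * E -> R) (gamma C : R)
  (X_iid : iid X)
  (N_normal : standard_normal N)
  (h_meas : measurable_fun setT h)
  (h_sym : forall x y : E, h (x, y) = h (y, x))
  (sigma1_pos : (0 < sigma1_sq X h)%E)
  (sigma1_fin : (sigma1_sq X h < +oo)%E)
  (gamma_ge1 : 1 <= gamma)
  (C_gt0 : 0 < C)
  (h_moments : forall j : nat, (3 <= j)%N ->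
     ('E_P[(fun w => `|h (X 0%N w, X 1%N w)| ^+ j)%R]
        <= (C ^+ j * (j`!%:R `^ gamma))%R%:E)%E)
  (k : nat) (k_even : ~~ odd k) (k_ge4 : (4 <= k)%N) :
  exists C1 : R, \forall n \near \oo,
    (`| 'E_P[(fun w => (Zstat X h n w) ^+ k)%R]
        - 'E_Q[(fun w => (N w) ^+ k)%R] |
       <= (C1 * n%:R^-1)%R%:E)%E.
Proof.
have mh01 : measurable_fun setT (fun w => h (X 0%N w, X 1%N w)).
  exact: (measurableT_comp h_meas (measurable_pair_RV X 0 1)).
have M01 : all_moments P (fun w => h (X 0%N w, X 1%N w)).
  (* At each fixed order the assumed bound is a finite real number. *)
  apply: all_momentsW => // p p3; have := h_moments p p3; rewrite unlock.
  by move=> /le_lt_trans; apply; exact: ltry.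
move: sigma1_pos; rewrite (sigma1_sqE X_iid h_meas M01) lte_fin => s_gt0.
have [q qk] : exists q, k = q.*2.
  by exists k./2; rewrite -[LHS]odd_double_half (negbTE k_even).
have q0 : (0 < q)%N by lia.
have [K1 K10 HK1] := mean_centered_sumX_approx X_iid h_meas h_sym M01 q0.
have [K2 K20 HK2] := mean_centered_sumX_approx X_iid h_meas h_sym M01 (ltn0Sn 0).
have [||C1 [r HC1]] := @ratio_asymptotics R
  (fun n => mean P (fun w => centered_sum X h n w ^+ q.*2))
  (fun n => mean P (fun w => centered_sum X h n w ^+ 2))
  (odd_dfact q)%:R (hoeffding1_moment X h 2) K1 K2 q q0 s_gt0 (ler0n _ _) K10 K20.
- by move=> n n0; rewrite -lead_momentE; exact: HK1.
- by move=> n n0; have := HK2 n n0; rewrite lead_momentE /= expr1 mul1r.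
exists C1; near=> n.
(* [n > 1] makes the binomial coefficient nonzero; the threshold [r] keeps the normalized variance
   away from 0. *)
have n1 : (1 < n)%N by near: n; exact: nbhs_infty_gt.
have rn : r <= n%:R by near: n; exact: nbhs_infty_ger.
rewrite qk (mean_Zstat_even X_iid h_meas M01)// (standard_normal_even_moment q N_normal).
by rewrite -EFinB abse_EFin lee_fin; apply: HC1 => //; exact: ltnW.
Unshelve. all: by end_near. Qed.
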